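(* Let $l,m,n$ be positive integers with $\frac1l+\frac1m+\frac1n\le 1$, and let $\mathcal H$ be a finite orientably regular hypermap of type $(l,m,n)$. Then $\mathcal H$ is covered by infinitely many (pairwise non-isomorphic) finite orientably regular chiral hypermaps of the same type $(l,m,n)$.
   Context: For positive integers $l,m,n$, let $\Delta^*=\Delta^*(l,m,n)=\langle r_0,r_1,r_2\mid r_0^2=r_1^2=r_2^2=(r_1r_2)^l=(r_2r_0)^m=(r_0r_1)^n=1\rangle$ be the extended triangle group of type $(l,m,n)$, and let $\Delta=\Delta(l,m,n)=\langle x,y,z\mid x^l=y^m=z^n=xyz=1\rangle$ be the triangle group of that type, identified with the index-$2$ subgroup of $\Delta^*$ of words of even length via $x=r_1r_2$, $y=r_2r_0$, $z=r_0r_1$. The type $(l,m,n)$ is non-spherical if $\frac1l+\frac1m+\frac1n\le 1$. Orientably regular hypermaps $\mathcal H$ of non-spherical type $(l,m,n)$, up to isomorphism of oriented hypermaps (orientation-preserving isomorphism), correspond bijectively to torsion-free normal subgroups $N$ of $\Delta$, with orientation-preserving automorphism group $\mathrm{Aut}^+\mathcal H\cong\Delta/N$. (For normal $N$ of finite index, torsion-freeness means that the images of $x,y,z$ in $\Delta/N$ have orders exactly $l,m,n$.) The hypermap $\mathcal H$ is finite if and only if $N$ has finite index in $\Delta$. The hypermap corresponding to $N_1$ covers the hypermap corresponding to $N$ if $N_1\le N$. The hypermap corresponding to $N$ is reflexible (regular) if $N$ is normal in $\Delta^*$, and chiral if $N$ is not normal in $\Delta^*$. *)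

(* Defs.v *)
From HB Require Import structures.
From mathcomp Require Import all_boot all_order all_algebra all_fingroup.
From mathcomp Require Import boolp classical_sets.

Set Implicit Arguments.
Unset Strict Implicit.
Unset Printing Implicit Defensive.

Local Open Scope group_scope.
Local Open Scope quotient_scope.

(** * Groups given by generators and relators *)

(** The letter [(a, false)] stands for the generator [a] and [(a, true)] for
    its inverse. *)
Definition word (X : choiceType) := seq (X * bool).

Definition winv (X : choiceType) (w : word X) : word X :=
  rev [seq (a.1, ~~ a.2) | a <- w].

Definition wpow (X : choiceType) (w : word X) (k : nat) : word X :=
  flatten (nseq k w).

Definition weval (X : choiceType) (G : groupType) (f : X -> G) (w : word X) : G :=
  \prod_(a <- w) (if a.2 then (f a.1)^-1 else f a.1).

Section Presentation.
Variables (X : choiceType) (rels : seq (word X)).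

Inductive wcong : word X -> word X -> Prop :=
| wcong_refl u : wcong u u
| wcong_sym u v : wcong u v -> wcong v u
| wcong_trans u v w : wcong u v -> wcong v w -> wcong u w
| wcong_cat u u' v v' : wcong u u' -> wcong v v' -> wcong (u ++ v) (u' ++ v')
| wcong_cancel a b : wcong [:: (a, b); (a, ~~ b)] [::]
| wcong_rel r : r \in rels -> wcong r [::].

Definition wcongb : rel (word X) := fun u v => `[< wcong u v >].

Lemma wcongb_refl : reflexive wcongb.
Proof. by move=> u; apply/asboolP; exact: wcong_refl. Qed.

Lemma wcongb_sym : symmetric wcongb.
Proof. by move=> u v; apply/asboolP/asboolP; exact: wcong_sym. Qed.

Lemma wcongb_trans : transitive wcongb.
Proof.
move=> v u w /asboolP uv /asboolP vw; apply/asboolP; exact: wcong_trans uv vw.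
Qed.

Canonical wcong_equiv := EquivRel wcongb wcongb_refl wcongb_sym wcongb_trans.

(** The group [< X | rels >]. *)
Definition presented : Type := {eq_quot wcong_equiv}.
HB.instance Definition _ := Choice.on presented.
HB.instance Definition _ := Quotient.on presented.

Lemma pres_eqP (u v : word X) :
  \pi_presented u = \pi_presented v <-> wcong u v.
Proof.
split=> [/eqmodP/asboolP//|uv]; apply/eqmodP; exact/asboolP.
Qed.

Lemma repr_cong (u : word X) : wcong (generic_quotient.repr (\pi_presented u)) u.
Proof. by apply/pres_eqP; rewrite reprK. Qed.

Definition pmul (g h : presented) : presented :=
  \pi_presented (generic_quotient.repr g ++ generic_quotient.repr h).
Definition pone : presented := \pi_presented [::].
Definition pinv (g : presented) : presented := \pi_presented (winv (generic_quotient.repr g)).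

Lemma winv_cat (u v : word X) : winv (u ++ v) = winv v ++ winv u.
Proof. by rewrite /winv map_cat rev_cat. Qed.

Lemma winvK : involutive (@winv X).
Proof.
move=> u; rewrite /winv map_rev revK -map_comp map_id_in // => -[a b] _ /=.
by rewrite negbK.
Qed.

Lemma wcong_winvr (w : word X) : wcong (w ++ winv w) [::].
Proof.
elim: w => [|[a b] w IHw]; first exact: wcong_refl.
have -> : ((a, b) :: w) ++ winv ((a, b) :: w)
    = [:: (a, b)] ++ (w ++ winv w) ++ [:: (a, ~~ b)].
  by rewrite -cat1s winv_cat !catA.
apply: wcong_trans (wcong_cancel a b).
apply: (wcong_cat (wcong_refl [:: (a, b)])).
exact: (wcong_cat IHw (wcong_refl [:: (a, ~~ b)])).
Qed.

Lemma wcong_winvl (w : word X) : wcong (winv w ++ w) [::].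
Proof. by rewrite -{2}(winvK w); exact: wcong_winvr. Qed.

Lemma pmulE (u v : word X) :
  pmul (\pi_presented u) (\pi_presented v) = \pi_presented (u ++ v).
Proof. by apply/pres_eqP; apply: wcong_cat; exact: repr_cong. Qed.

Lemma pmulA : associative pmul.
Proof.
elim/quotW=> u; elim/quotW=> v; elim/quotW=> w.
by rewrite (pmulE v w) (pmulE u v) !pmulE catA.
Qed.

Lemma pmul1 : left_id pone pmul.
Proof. by move=> g; rewrite -[g]reprK /pone pmulE. Qed.

Lemma pmulr1 : right_id pone pmul.
Proof. by move=> g; rewrite -[g]reprK /pone pmulE cats0. Qed.

Lemma pmulV : left_inverse pone pinv pmul.
Proof.
move=> g; rewrite -{2}[g]reprK pmulE; apply/pres_eqP; exact: wcong_winvl.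
Qed.

Lemma pmulrV : right_inverse pone pinv pmul.
Proof.
move=> g; rewrite -{1}[g]reprK pmulE; apply/pres_eqP; exact: wcong_winvr.
Qed.

HB.instance Definition _ :=
  isGroup.Build presented pmulA pmul1 pmulr1 pmulV pmulrV.

Definition pgen (a : X) : presented := \pi_presented [:: (a, false)].

(** The homomorphism extending [f]; see [pliftE] for its domain of validity. *)
Definition plift (G : groupType) (f : X -> G) (g : presented) : G :=
  weval f (generic_quotient.repr g).

Section Lift.
Variables (G : groupType) (f : X -> G).
Hypothesis frels : forall r, r \in rels -> weval f r = 1.

Lemma weval_cat (u v : word X) : weval f (u ++ v) = weval f u * weval f v.
Proof. by rewrite /weval big_cat. Qed.

Lemma weval_cong u v : wcong u v -> weval f u = weval f v.
Proof.
elim=> {u v} [//|u v _ ->//|u v w _ -> _ ->//|u u' v v' _ IHu _ IHv|a b|r rr].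
- by rewrite !weval_cat IHu IHv.
- by rewrite /weval !big_cons !big_nil mulg1; case: b; rewrite ?mulgV ?mulVg.
- by rewrite frels // /weval big_nil.
Qed.

Lemma pliftE (w : word X) : plift f (\pi_presented w) = weval f w.
Proof. exact: weval_cong (repr_cong w). Qed.

Lemma pliftM : {morph plift f : g h / g * h}.
Proof.
move=> g h; rewrite -[g]reprK -[h]reprK.
by rewrite [_ * _]pmulE !pliftE weval_cat.
Qed.

Lemma plift_gen (a : X) : plift f (pgen a) = f a.
Proof. by rewrite pliftE /weval big_seq1. Qed.

End Lift.

Lemma weval_pgen (w : word X) : weval pgen w = \pi_presented w.
Proof.
elim: w => [|[a b] w IHw]; first by rewrite /weval big_nil.
rewrite /weval big_cons -/(weval pgen w) IHw /=.
have -> : (if b then (pgen a)^-1 else pgen a) = \pi_presented [:: (a, b)].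
  case: b => //; apply: (mulgI (pgen a)); rewrite mulgV.
  apply/esym; rewrite [LHS]pmulE; apply/pres_eqP; exact: (wcong_cancel a false).
exact: pmulE.
Qed.

Lemma weval_pgen_rel r : r \in rels -> weval pgen r = 1.
Proof.
by move=> rr; rewrite weval_pgen; apply/pres_eqP; exact: wcong_rel.
Qed.

End Presentation.

(** * Triangle groups *)

Definition i0 : 'I_3 := inord 0.
Definition i1 : 'I_3 := inord 1.
Definition i2 : 'I_3 := inord 2.

Definition letter (i : 'I_3) : word 'I_3 := [:: (i, false)].

Definition ext_triangle_rels (l m n : nat) : seq (word 'I_3) :=
  [:: wpow (letter i0) 2; wpow (letter i1) 2; wpow (letter i2) 2;
      wpow (letter i1 ++ letter i2) l;
      wpow (letter i2 ++ letter i0) m;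
      wpow (letter i0 ++ letter i1) n].

(** [Delta^*(l,m,n)], with generators [r_0, r_1, r_2]. *)
Definition ext_triangle_group (l m n : nat) : groupType :=
  presented (ext_triangle_rels l m n).

(** The generators [x, y, z] of [Delta] are indexed by [i0, i1, i2]. *)
Definition triangle_rels (l m n : nat) : seq (word 'I_3) :=
  [:: wpow (letter i0) l; wpow (letter i1) m; wpow (letter i2) n;
      letter i0 ++ letter i1 ++ letter i2].

(** [Delta(l,m,n)]. *)
Definition triangle_group (l m n : nat) : groupType :=
  presented (triangle_rels l m n).

Definition ord3_case (T : Type) (a b c : T) (i : 'I_3) : T :=
  if i == i0 then a else if i == i1 then b else c.

(** The identification of [Delta] with the subgroup of words of even length of
    [Delta^*]: [x = r_1 r_2], [y = r_2 r_0], [z = r_0 r_1]. *)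
Definition triangle_incl (l m n : nat) :
    triangle_group l m n -> ext_triangle_group l m n :=
  let r i : ext_triangle_group l m n := pgen _ i in
  plift (ord3_case (r i1 * r i2) (r i2 * r i0) (r i0 * r i1)).

Definition normal_in (G : groupType) (A : set G) : Prop :=
  forall g h : G, A g -> A (g ^ h).

(** * Finite oriented hypermaps *)

(** A finite oriented hypermap is a finite nonempty set of darts with a
    transitive action of the group [<x, y, z | xyz = 1>]; permutations are
    composed from left to right.  ([atrans] entails nonemptiness.) *)
Record hypermap := Hypermap {
  dart : finType;
  hx : {perm dart};
  hy : {perm dart};
  hz : {perm dart};
  hypermap_xyz : hx * hy * hz = 1;
  hypermap_trans :
    [transitive <<[set hx; hy; hz]>>, on [set: dart] | 'P]
}.

Definition has_type (l m n : nat) (H : hypermap) : Prop :=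
  [/\ #[hx H] = l, #[hy H] = m & #[hz H] = n].

(** Orientation-preserving isomorphisms. *)
Definition is_iso (H K : hypermap) (f : dart H -> dart K) : Prop :=
  [/\ bijective f,
      forall d, f (hx H d) = hx K (f d),
      forall d, f (hy H d) = hy K (f d) &
      forall d, f (hz H d) = hz K (f d)].

Definition isomorphic (H K : hypermap) : Prop :=
  exists f : dart H -> dart K, is_iso f.

(** [Aut^+ H] is transitive on the darts. *)
Definition orientably_regular (H : hypermap) : Prop :=
  forall d d' : dart H, exists2 f : dart H -> dart H, is_iso f & f d = d'.

(** The action of [Delta(l,m,n)] on the darts of a hypermap of type
    [(l,m,n)]. *)
Definition monodromy (l m n : nat) (H : hypermap) :
    triangle_group l m n -> {perm dart H} :=
  plift (ord3_case (hx H) (hy H) (hz H)).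
Arguments monodromy : clear implicits.

(** The subgroup [N] of [Delta(l,m,n)] corresponding to an orientably regular
    hypermap [H] of type [(l,m,n)].  In general the subgroup corresponding to
    [H] is the stabiliser of a dart, defined up to conjugacy; when [H] is
    orientably regular the stabilisers of all darts coincide, hence are equal
    to the kernel of the action. *)
Definition hypermap_subgroup (l m n : nat) (H : hypermap) :
    set (triangle_group l m n) :=
  [set g | monodromy l m n H g = 1]%classic.
Arguments hypermap_subgroup : clear implicits.

(** [covers l m n K H]: the hypermap [K] covers [H], both being orientably
    regular of type [(l,m,n)]. *)
Definition covers (l m n : nat) (K H : hypermap) : Prop :=
  (hypermap_subgroup l m n K `<=` hypermap_subgroup l m n H)%classic.

Definition reflexible (l m n : nat) (H : hypermap) : Prop :=
  normal_in (@triangle_incl l m n @` hypermap_subgroup l m n H)%classic.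

Definition chiral (l m n : nat) (H : hypermap) : Prop :=
  ~ reflexible l m n H.

(** The two maps defined through [plift] are homomorphisms. *)

Lemma i10 : (i1 == i0) = false.
Proof. by rewrite -val_eqE /= !inordK. Qed.
Lemma i20 : (i2 == i0) = false.
Proof. by rewrite -val_eqE /= !inordK. Qed.
Lemma i21 : (i2 == i1) = false.
Proof. by rewrite -val_eqE /= !inordK. Qed.

Variant ord3_spec (i : 'I_3) : Prop :=
| Ord3_0 of i = i0 | Ord3_1 of i = i1 | Ord3_2 of i = i2.

Lemma ord3P i : ord3_spec i.
Proof.
case: i => -[|[|[|//]]] lti; [apply: Ord3_0|apply: Ord3_1|apply: Ord3_2];
  by apply: val_inj; rewrite /= inordK.
Qed.

Lemma weval_letter (G : groupType) (f : 'I_3 -> G) i : weval f (letter i) = f i.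
Proof. by rewrite /weval big_seq1. Qed.

Lemma weval_pow (X : choiceType) (G : groupType) (f : X -> G) w k :
  weval f (wpow w k) = weval f w ^+ k.
Proof.
elim: k => [|k IHk]; first by rewrite /weval big_nil.
by rewrite expgS -IHk -weval_cat.
Qed.

Lemma monodromyM (l m n : nat) (H : hypermap) :
  has_type l m n H -> {morph monodromy l m n H : g h / g * h}.
Proof.
case=> hl hm hn; apply: pliftM => r; rewrite !inE.
case/or4P => /eqP->;
  rewrite ?weval_cat ?weval_pow !weval_letter /ord3_case ?eqxx ?i10 ?i20 ?i21.
- by rewrite -hl expg_order.
- by rewrite -hm expg_order.
- by rewrite -hn expg_order.
- by rewrite mulgA hypermap_xyz.
Qed.

Lemma triangle_inclM (l m n : nat) :
  {morph @triangle_incl l m n : g h / g * h}.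
Proof.
apply: pliftM => s; rewrite !inE.
set r := fun i => pgen (ext_triangle_rels l m n) i.
have rel w : w \in ext_triangle_rels l m n -> weval r w = 1.
  exact: weval_pgen_rel.
have rr i : r i * r i = 1.
  have := rel (wpow (letter i) 2); rewrite weval_pow weval_letter expg2; apply.
  by rewrite !inE; case: (ord3P i) => ->; rewrite eqxx ?orbT.
case/or4P => /eqP->;
  rewrite ?weval_cat ?weval_pow !weval_letter /ord3_case ?eqxx ?i10 ?i20 ?i21.
- have := rel (wpow (letter i1 ++ letter i2) l).
  by rewrite weval_pow weval_cat !weval_letter; apply; rewrite !inE eqxx ?orbT.
- have := rel (wpow (letter i2 ++ letter i0) m).
  by rewrite weval_pow weval_cat !weval_letter; apply; rewrite !inE eqxx ?orbT.
- have := rel (wpow (letter i0 ++ letter i1) n).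
  by rewrite weval_pow weval_cat !weval_letter; apply; rewrite !inE eqxx ?orbT.
- rewrite -/(r i0) -/(r i1) -/(r i2) !mulgA -(mulgA (r i1)) rr mulg1.
  by rewrite -(mulgA (r i1)) rr mulg1 rr.
Qed.

(* Main.v *)
(** A hypermap H of type (l,m,n) corresponds to a kernel N in Delta.  Replacing
    N by its intersection with its mirror image, G = Delta/N carries an
    automorphism sg inverting the images a, b of x, y.  On the bipartite (Walsh)
    map of H, whose edges are the darts, the harmonic integral 1-forms make up
    the homology of the surface; it is nonzero because 1/l + 1/m + 1/n <= 1.
    Composing the rotation about the vertices with the harmonic projection gives
    an integral operator B on Z[G], the intersection form in disguise: it
    commutes with G, anticommutes with sg, and is injective on harmonic forms by
    Poincare duality.  Hence the characteristic polynomial of B has a nonzero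
    root c modulo arbitrarily large primes p (Schur).  The elements of N whose
    homology class mod p is sent by B into the c-eigenspace form the kernel of a
    finite cover of H, and the mirror image of that kernel belongs to the
    eigenvalue -c, so the cover is chiral.  Iterating yields a strictly
    decreasing sequence of kernels, hence pairwise non-isomorphic covers. *)

Require Import Defs.
From mathcomp Require Import all_boot all_order all_algebra all_fingroup cyclic.
From mathcomp Require Import lra ring zify boolp.

Set Implicit Arguments.
Unset Strict Implicit.
Unset Printing Implicit Defensive.

Import Order.TTheory GRing.Theory Num.Theory.

Local Open Scope ring_scope.

(** * Cyclic sums and integer matrices *)

Definition cyc_norm (R : pzRingType) (x : R) (k : nat) : R := \sum_(i < k) x ^+ i.
(** When [x ^+ k = 1], it inverts [1 - x] up to the factor [- k] on the kernel of [cyc_norm x k]. *)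
Definition cyc_moment (R : pzRingType) (x : R) (k : nat) : R :=
  \sum_(i < k) x ^+ i *+ i.

Section CyclicSums.
Variables (R : pzRingType) (x : R) (k : nat).
Hypothesis xk : x ^+ k = 1.

Lemma mul_cyc_norm : x * cyc_norm x k = cyc_norm x k.
Proof.
rewrite /cyc_norm; case: k xk => [|j] xj; first by rewrite big_ord0 mulr0.
rewrite mulr_sumr big_ord_recr [RHS]big_ord_recl /= -exprS xj expr0 addrC.
by congr (_ + _); apply: eq_bigr => i _; rewrite -exprS.
Qed.

Lemma cyc_norm_mul : cyc_norm x k * x = cyc_norm x k.
Proof.
rewrite -[RHS]mul_cyc_norm /cyc_norm mulr_suml mulr_sumr.
by apply: eq_bigr => i _; rewrite -exprS -exprSr.
Qed.

Lemma exp_cyc_norm i : x ^+ i * cyc_norm x k = cyc_norm x k.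
Proof. by elim: i => [|i IHi]; rewrite ?mul1r // exprSr -mulrA mul_cyc_norm. Qed.

Lemma cyc_norm_sqr : cyc_norm x k * cyc_norm x k = cyc_norm x k *+ k.
Proof.
rewrite {1}/cyc_norm mulr_suml (eq_bigr (fun=> cyc_norm x k)).
  by rewrite sumr_const card_ord.
by move=> i _; rewrite exp_cyc_norm.
Qed.

Lemma mul_cyc_moment : (1 - x) * cyc_moment x k = cyc_norm x k - k%:R.
Proof.
suff E j : (1 - x) * cyc_moment x j = x * cyc_norm x j - x ^+ j *+ j.
  by rewrite E xk mul_cyc_norm.
elim: j => [|j IHj]; first by rewrite /cyc_moment /cyc_norm !big_ord0 !mulr0 subr0.
rewrite /cyc_moment /cyc_norm !big_ord_recr /= -/(cyc_moment _ _) -/(cyc_norm _ _).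
rewrite !mulrDr IHj mulrnAr mulrBl mul1r -exprS mulrnBl addrA subrK.
by rewrite mulrS opprD addrA addrK.
Qed.
End CyclicSums.

Lemma cyc_norm_commE (R : pzRingType) (s x y : R) k :
  s * x = y * s -> s * cyc_norm x k = cyc_norm y k * s.
Proof.
move=> sx; rewrite mulr_sumr mulr_suml; apply: eq_bigr => i _.
elim: (i : nat) => [|j IHj]; first by rewrite mulr1 mul1r.
by rewrite exprS mulrA sx -mulrA IHj mulrA -exprS.
Qed.

Lemma cyc_moment_commE (R : pzRingType) (s x y : R) k :
  s * x = y * s -> s * cyc_moment x k = cyc_moment y k * s.
Proof.
move=> sx; rewrite mulr_sumr mulr_suml; apply: eq_bigr => i _.
rewrite mulrnAr mulrnAl; congr (_ *+ _).
elim: (i : nat) => [|j IHj]; first by rewrite mulr1 mul1r.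
by rewrite exprS mulrA sx -mulrA IHj mulrA -exprS.
Qed.

Lemma trmx_exp (n i : nat) (A : 'M[int]_n) : (A ^+ i)^T = A^T ^+ i.
Proof.
elim: i => [|i IHi]; first by rewrite !expr0 trmx1.
by rewrite exprS exprSr -IHi; exact: trmx_mul.
Qed.

Lemma cyc_norm_tr (n k : nat) (A : 'M[int]_n) : (cyc_norm A k)^T = cyc_norm A^T k.
Proof.
by rewrite /cyc_norm linear_sum; apply: eq_bigr => i _; rewrite /= trmx_exp.
Qed.

Lemma cyc_moment_tr (n k : nat) (A : 'M[int]_n) :
  (cyc_moment A k)^T = cyc_moment A^T k.
Proof.
rewrite /cyc_moment linear_sum; apply: eq_bigr => i _.
by rewrite raddfMn /= trmx_exp.
Qed.

Lemma sqnorm_ge0 (n : nat) (v : 'cV[int]_n) : 0 <= (v^T *m v) 0 0.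
Proof. by rewrite mxE sumr_ge0 // => i _; rewrite mxE -expr2 sqr_ge0. Qed.

Lemma sqnorm_eq0 (n : nat) (v : 'cV[int]_n) : (v^T *m v) 0 0 = 0 -> v = 0.
Proof.
rewrite mxE => /eqP; rewrite psumr_eq0 => [/allP v0|i _]; last first.
  by rewrite mxE -expr2 sqr_ge0.
apply/colP => i; have := v0 i (mem_index_enum i); rewrite !mxE mulf_eq0 orbb.
by move/eqP.
Qed.

Lemma gram_eq0 (n k : nat) (M : 'M[int]_(n, k)) : M^T *m M = 0 -> M = 0.
Proof.
move=> MM; apply/matrixP => i j; have: col j M = 0.
  apply: sqnorm_eq0; transitivity ((M^T *m M) j j); last by rewrite MM mxE.
  by rewrite !mxE; apply: eq_bigr => i' _; rewrite !mxE.
by move/colP/(_ i); rewrite !mxE.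
Qed.

(** A symmetric integer matrix has no nilpotent part: once [L ^+ s.+2 * M] vanishes, so does the
    Gram matrix of [L ^+ s.+1 * M], and the exponent descends. *)
Lemma sym_exp_mul_eq0 (n s : nat) (L M : 'M[int]_n) :
  L^T = L -> L ^+ s * M = 0 -> L * M = 0.
Proof.
move=> Ls; elim: s => [|s IHs]; first by rewrite mul1r => ->; rewrite mulr0.
case: s IHs => [|s] IHs; first by rewrite expr1.
move=> L0; apply: IHs; apply: gram_eq0.
have E : L ^+ s.+1 * (L ^+ s.+1 * M) = 0.
  by rewrite mulrA -exprD addSnnS exprD -mulrA L0 mulr0.
rewrite [_ * M]/(_ *m M) trmx_mul trmx_exp Ls -mulmxA.
by rewrite [X in _ *m X]E mulmx0.
Qed.

Lemma horner_mx_tr (n : nat) (A : 'M[int]_n.+1) (p : {poly int}) :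
  (horner_mx A p)^T = horner_mx A^T p.
Proof.
elim/poly_ind: p => [|p c IHp]; first by rewrite !rmorph0 linear0.
rewrite !rmorphD !rmorphM /= !horner_mx_C !horner_mx_X linearD /=.
rewrite tr_scalar_mx -mulmxE trmx_mul IHp; congr (_ + _).
exact: (comm_mx_horner p (comm_mx_refl _)).
Qed.

Lemma polyX_mult (p : {poly int}) :
  p != 0 -> exists s q, p = 'X ^+ s * q /\ q.[0] != 0.
Proof.
move=> p0; have [s [q qr ->]] := multiplicity_XsubC p 0.
exists s, q; rewrite mulrC subr0; split=> //.
by move: qr; rewrite p0 /= /root.
Qed.

Lemma poly_const_term (p : {poly int}) : exists r, p = 'X * r + (p.[0])%:P.
Proof.
have [r Er] : exists r, p - (p.[0])%:P = r * ('X - 0%:P).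
  by apply/factor_theorem; rewrite /root !hornerE subrr.
by exists r; rewrite subr0 in Er; rewrite mulrC -Er subrK.
Qed.

(** * The harmonic projection and the rotation operator *)

Lemma mx_mulrnI (p q k : nat) : (0 < k)%N ->
  injective (fun A : 'M[int]_(p, q) => A *+ k).
Proof.
move=> k0 A B /matrixP E; apply/matrixP => i j.
by apply/eqP; rewrite -(eqr_pMn2r k0) -!mulmxnE E.
Qed.

(** [A * N = N] and orthogonality give [A^T * N = N], hence [N^T * N = N *+ k]; a Gram matrix is
    symmetric, and [k] can be cancelled. *)
Lemma cyc_norm_sym (n k : nat) (A : 'M[int]_n) :
  (0 < k)%N -> A^T * A = 1 -> A ^+ k = 1 -> (cyc_norm A k)^T = cyc_norm A k.
Proof.
move=> k0 AA Ak; set N := cyc_norm A k.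
have AN : A^T * N = N by rewrite -{1}[N](mul_cyc_norm Ak) mulrA AA mul1r.
have NN : N^T * N = N *+ k.
  rewrite {1}/N cyc_norm_tr mulr_suml (eq_bigr (fun=> N)) ?sumr_const ?card_ord //.
  move=> i _; elim: (i : nat) => [|j IHj]; first by rewrite mul1r.
  by rewrite exprSr -mulrA AN.
apply: (mx_mulrnI k0); rewrite -NN -raddfMn /= -NN.
by rewrite [LHS]trmx_mul trmxK.
Qed.

Lemma mulmx_mul (n p : nat) (A B : 'M[int]_n) (v : 'M[int]_(n, p)) :
  (A * B) *m v = A *m (B *m v).
Proof. by rewrite mulmxA. Qed.

Lemma mulmx_mulrnr (p q r k : nat) (A : 'M[int]_(p, q)) (B : 'M_(q, r)) :
  A *m (B *+ k) = (A *m B) *+ k.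
Proof. exact: raddfMn. Qed.

Lemma mulmx_mulrnl (p q r k : nat) (A : 'M[int]_(p, q)) (B : 'M_(q, r)) :
  (A *+ k) *m B = (A *m B) *+ k.
Proof. by rewrite -!scaler_nat scalemxAl. Qed.

Lemma addmxE (p q : nat) (A B : 'M[int]_(p, q)) i j :
  (A + B) i j = A i j + B i j.
Proof. by rewrite mxE. Qed.

Section NormForm.
Variables (n k : nat) (N : 'M[int]_n).
Hypotheses (k0 : (0 < k)%N) (Ns : N^T = N) (NN : N * N = N *+ k).

(** Up to the factor [k], [N] is an orthogonal projection, so its quadratic form is a squared norm
    and vanishes only on the kernel of [N]. *)
Lemma norm_form (v : 'cV[int]_n) :
  (v^T *m (N *m v)) 0 0 *+ k = ((N *m v)^T *m (N *m v)) 0 0.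
Proof.
rewrite trmx_mul Ns -(mulmxA v^T) (mulmxA N N) [N *m N]NN.
by rewrite mulmx_mulrnl mulmx_mulrnr mulmxnE.
Qed.

Lemma norm_form_ge0 (v : 'cV[int]_n) : 0 <= (v^T *m (N *m v)) 0 0.
Proof. by rewrite -(pmulrn_lge0 _ k0) norm_form sqnorm_ge0. Qed.

Lemma norm_form_eq0 (v : 'cV[int]_n) : (v^T *m (N *m v)) 0 0 = 0 -> N *m v = 0.
Proof. by move=> v0; apply: sqnorm_eq0; rewrite -norm_form v0 mul0rn. Qed.
End NormForm.

Section Hodge.
Variables (n : nat) (X Y : 'M[int]_n.+1) (l m k : nat).
Hypotheses (l_gt0 : (0 < l)%N) (m_gt0 : (0 < m)%N) (k_gt0 : (0 < k)%N).
Hypotheses (XX : X^T * X = 1) (YY : Y^T * Y = 1).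
Hypotheses (Xl : X ^+ l = 1) (Ym : Y ^+ m = 1) (Wk : (Y * X) ^+ k = 1).

Local Notation W := (Y * X).
Local Notation Nx := (cyc_norm X l).
Local Notation Ny := (cyc_norm Y m).
Local Notation Nw := (cyc_norm W k).

(* The darts are the edges of a bipartite map with the cycles of X and Y as its
   black and white vertices and those of Y X as its faces. *)
Definition laplacian : 'M[int]_n.+1 := Nx + Ny + (1 - Y^T) * Nw * (1 - Y).

Lemma mul_X_trX : X * X^T = 1. Proof. exact: mulmx1C. Qed.
Lemma mul_Y_trY : Y * Y^T = 1. Proof. exact: mulmx1C. Qed.

Lemma orthogonal_W : W^T * W = 1.
Proof. by rewrite [W^T]trmx_mul -[_ *m _]/(_ * _) mulrA -(mulrA X^T) YY mulr1 XX. Qed.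

Lemma Nx_sym : Nx^T = Nx. Proof. exact: cyc_norm_sym. Qed.
Lemma Ny_sym : Ny^T = Ny. Proof. exact: cyc_norm_sym. Qed.
Lemma Nw_sym : Nw^T = Nw. Proof. exact: cyc_norm_sym orthogonal_W Wk. Qed.

Lemma trmx_1sub (A : 'M[int]_n.+1) : (1 - A)^T = 1 - A^T.
Proof. by rewrite linearB /= trmx1. Qed.

Lemma laplacian_sym : laplacian^T = laplacian.
Proof.
rewrite /laplacian !linearD /= Nx_sym Ny_sym; congr (_ + _).
rewrite -!mulmxE !trmx_mul Nw_sym !trmx_1sub trmxK; exact: mulrA.
Qed.

(** The first two equations say that [h] is a cycle, balanced at black and white vertices. The third
    says that it is closed: its circulation around each face is zero, the boundary of a face running
    along pairs of [Y]-consecutive edges with opposite signs. *)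
Definition harmonic (h : 'cV[int]_n.+1) : Prop :=
  [/\ Nx *m h = 0, Ny *m h = 0 & Nw *m ((1 - Y) *m h) = 0].

Lemma laplacianE p (v : 'M_(n.+1, p)) :
  laplacian *m v = Nx *m v + Ny *m v + (1 - Y^T) *m (Nw *m ((1 - Y) *m v)).
Proof. by rewrite /laplacian 2!mulmxDl !mulmx_mul. Qed.

(** The Laplacian is a sum of three positive semidefinite forms, so pairing [laplacian *m h = 0]
    with [h] kills each of them. *)
Lemma harmonicP h : harmonic h <-> laplacian *m h = 0.
Proof.
rewrite laplacianE; split=> [[-> -> ->]|L0]; first by rewrite mulmx0 !addr0.
have fx := norm_form_ge0 l_gt0 Nx_sym (cyc_norm_sqr Xl) h.
have fy := norm_form_ge0 m_gt0 Ny_sym (cyc_norm_sqr Ym) h.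
have fw := norm_form_ge0 k_gt0 Nw_sym (cyc_norm_sqr Wk) ((1 - Y) *m h).
have := congr1 (fun w : 'cV_n.+1 => (h^T *m w) 0 0) L0.
rewrite /= mulmx0 !mulmxDr !addmxE (mulmxA h^T (1 - Y^T)).
rewrite -trmx_1sub -trmx_mul [RHS]mxE.
move/eqP; rewrite !paddr_eq0 ?addr_ge0 // -andbA => /and3P[/eqP x0 /eqP y0 /eqP w0].
split.
- exact: norm_form_eq0 Nx_sym (cyc_norm_sqr Xl) _ x0.
- exact: norm_form_eq0 Ny_sym (cyc_norm_sqr Ym) _ y0.
- exact: norm_form_eq0 Nw_sym (cyc_norm_sqr Wk) _ w0.
Qed.

(* Poincare duality: u and v are primitives of h around the black and the white
   vertices.  Pairing with c shows that c is Y-invariant, so that u is constant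
   around the faces and h is both a boundary and a closed form. *)
Lemma duality_core (u v h c0 c : 'cV[int]_n.+1) :
    X *m u = u + h -> Y *m v = v + h -> u + v = (1 - Y^T) *m c - h ->
    c = Nw *m c0 -> Nw *m ((1 - Y) *m h) = 0 -> h = 0.
Proof.
move=> Xu Yv uv Ec Mh.
have Wc : W^T *m c = c.
  by rewrite Ec -mulmx_mul -{1}(mul_cyc_norm Wk) mulrA orthogonal_W mul1r.
have YYc : Y *m (Y^T *m c) = c by rewrite -mulmx_mul mul_Y_trY mul1mx.
have Y1 : (1 - Y^T) *m c = c - Y^T *m c by rewrite mulmxBl mul1mx.
have uYv : u + Y *m v = c - Y^T *m c by rewrite Yv addrA uv Y1 subrK.
have Wu : W *m u = u + (Y *m c + Y^T *m c - c *+ 2).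
  have Xuv : X *m u + v = c - Y^T *m c by rewrite Xu addrAC uv Y1 subrK.
  have := congr1 (mulmx Y) Xuv; rewrite mulmxDr -mulmx_mul mulmxBr YYc => E.
  move: uYv E; move: (W *m u) (Y *m v) (Y *m c) (Y^T *m c) => a b d e.
  by move=> /matrixP F /matrixP E; apply/matrixP => i j; move: (E i j) (F i j);
     rewrite !mxE => E1 F1; lra.
(* Pairing [Wu] with the [W]-invariant [c] makes [c] orthogonal to [Y c + Y^T c - 2 c]; that product
   is minus the squared norm of [Y c - c]. *)
have Yc : Y *m c = c.
  apply/eqP; rewrite -subr_eq0; apply/eqP/sqnorm_eq0.
  have cWu : (c^T *m (W *m u)) 0 0 = (c^T *m u) 0 0.
    by rewrite mulmxA -[c^T *m W]trmxK trmx_mul trmxK Wc.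
  move: cWu; rewrite Wu mulmxDr [in LHS]mxE => /eqP.
  rewrite -subr_eq0 addrAC subrr add0r => /eqP cWu.
  rewrite [(_ - _)^T]linearB /= trmx_mul mulmxBl mulmxBr (mulmxBr (c^T)).
  rewrite -(mulmxA _ _ (Y *m c)) (mulmxA Y^T) [Y^T *m Y]YY mul1mx -!mulmxA.
  move: cWu; rewrite mulmxBr mulmxDr mulmx_mulrnr.
  move: (_ *m _) (_ *m _) (_ *m _) => a b d.
  by rewrite !mxE => E; lra.
have Ytc : Y^T *m c = c by rewrite -{1}Yc -mulmx_mul YY mul1mx.
have Wu' : W *m u = u by rewrite Wu Yc Ytc -mulr2n subrr addr0.
have hE : h = - (1 - Y^T) *m u.
  rewrite mulNmx mulmxBl mul1mx opprB -{1}Wu' -!mulmx_mul mulrA YY mul1r Xu.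
  by rewrite addrC addrA addNr add0r.
have Nu : Nw *m u = u *+ k.
  rewrite /cyc_norm mulmx_suml (eq_bigr (fun=> u)) ?sumr_const ?card_ord //.
  move=> i _; elim: (i : nat) => [|j IHj]; first by rewrite mul1mx.
  by rewrite exprSr mulmx_mul Wu'.
(* In the pairing of [h] with [h *+ k], the factors [Nw] and [1 - Y] move onto [h], where [Mh]
   applies. *)
have hk : h *+ k = - (1 - Y^T) *m (Nw *m u).
  by rewrite Nu mulmx_mulrnr -hE.
apply: sqnorm_eq0; apply/eqP; suff: (h^T *m h) 0 0 *+ k == 0.
  by rewrite mulrn_eq0 gtn_eqF.
rewrite -mulmxnE -mulmx_mulrnr hk mulNmx mulmxN -trmx_1sub mulmxA -trmx_mul.
by rewrite mulmxA -{1}Nw_sym -trmx_mul Mh trmx0 mul0mx oppr0 mxE.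
Qed.

Lemma mx_eq0_cV (A : 'M[int]_n.+1) :
  (forall v : 'cV_n.+1, A *m v = 0) -> A = 0.
Proof.
by move=> A0; apply/matrixP => i j; move/colP/(_ i): (A0 (delta_mx j 0));
   rewrite -colE !mxE.
Qed.

(* Q is the value at the Laplacian of its characteristic polynomial stripped of
   its powers of 'X, hence q0 times the orthogonal projection. *)
Lemma harmonic_projector :
  exists Q : 'M[int]_n.+1, exists (q0 : int) (R : 'M[int]_n.+1),
    [/\ q0 != 0, Q^T = Q /\ laplacian * Q = 0, Q = q0%:M + laplacian * R,
        laplacian * R = R * laplacian &
        forall S, S * laplacian = laplacian * S -> S * Q = Q * S].
Proof.
have [|s [q [Eq q0]]] := polyX_mult (p := char_poly laplacian).
  exact/monic_neq0/char_poly_monic.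
have [r Er] := poly_const_term q.
exists (horner_mx laplacian q), q.[0], (horner_mx laplacian r); split=> //.
- split; first by rewrite horner_mx_tr laplacian_sym.
  apply: (@sym_exp_mul_eq0 _ s) laplacian_sym _.
  have := Cayley_Hamilton laplacian.
  by rewrite Eq rmorphM rmorphXn /= horner_mx_X.
- by rewrite {1}Er rmorphD rmorphM /= horner_mx_X horner_mx_C addrC.
- exact: comm_mx_horner.
- by move=> S SL; exact: comm_mx_horner.
Qed.

(* On functions with zero sum over every vertex this is l m times the sum of
   the Cayley transforms (1 + X) / (1 - X) and (1 + Y) / (1 - Y): the
   intersection form of the ribbon graph, summed over the vertices. *)
Definition rotation : 'M[int]_n.+1 :=
  (cyc_moment X l - (cyc_moment X l)^T) *+ m
  + (cyc_moment Y m - (cyc_moment Y m)^T) *+ l.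

(** On the kernel of the norm, [1 - A] sends the moment to [- j] and its transpose, the moment of
    the inverse of [A], to [j A]. *)
Lemma moment_skew (A : 'M[int]_n.+1) j (h : 'cV_n.+1) :
  A^T * A = 1 -> A ^+ j = 1 -> cyc_norm A j *m h = 0 -> (0 < j)%N ->
  (1 - A) *m ((cyc_moment A j - (cyc_moment A j)^T) *m h) = - (h + A *m h) *+ j.
Proof.
move=> AA Aj Nh j0.
have AAt : A * A^T = 1 by exact: mulmx1C.
have E1 : (1 - A) * cyc_moment A j = cyc_norm A j - j%:R by exact: mul_cyc_moment.
have E2 : (1 - A) * (cyc_moment A j)^T = A *+ j - cyc_norm A j.
  have Atj : A^T ^+ j = 1 by rewrite -trmx_exp Aj trmx1.
  rewrite cyc_moment_tr; have -> : 1 - A = - A * (1 - A^T).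
    by rewrite mulrBr mulr1 mulNr AAt opprK addrC.
  rewrite -mulrA mul_cyc_moment // -cyc_norm_tr cyc_norm_sym //.
  by rewrite mulNr mulrBr mul_cyc_norm // opprB mulr_natr.
rewrite -mulmx_mul mulrBr E1 E2 !mulmxBl Nh !mulmx_mulrnl mul1mx.
by rewrite sub0r subr0 -opprD -mulrnDl mulNrn.
Qed.

(** If [Q] kills [rotation *m h], then [q0 *: (rotation *m h)] is minus a Laplacian
    [laplacian *m g]. Sharing its vertex and face terms among [u], [v] and [c] puts a multiple of
    [h] in the situation of [duality_core]. *)
Lemma rotation_duality (Q R : 'M[int]_n.+1) (q0 : int) (h : 'cV_n.+1) :
  q0 != 0 -> Q = q0%:M + laplacian * R -> harmonic h ->
  Q *m (rotation *m h) = 0 -> h = 0.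
Proof.
move=> q00 EQ [hx hy hw] Q0.
set U := (cyc_moment X l - (cyc_moment X l)^T) *m h.
set V := (cyc_moment Y m - (cyc_moment Y m)^T) *m h.
have XU : (1 - X) *m U = - (h + X *m h) *+ l by exact: moment_skew.
have YV : (1 - Y) *m V = - (h + Y *m h) *+ m by exact: moment_skew.
pose g := R *m (rotation *m h).
have Eu : q0 *: (U *+ m + V *+ l) + laplacian *m g = 0.
  move: Q0; rewrite EQ mulmxDl mul_scalar_mx mulmx_mul -/g.
  by rewrite {1}/rotation mulmxDl !mulmx_mulrnl.
clearbody U V.
(* In [X u - u], the term [h + X h] coming from [U] and the term [h - X h] coming from the
   correction [- h *+ (l * m)] add up to [2 h]; the summand [Nx *m g] is [X]-invariant. The same
   holds for [v]. *)
pose kap := (q0 *+ (2 * l * m)) *: h.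
have k0 : kap = 0.
  have N0 (A : 'M[int]_n.+1) j (w : 'cV_n.+1) :
      A ^+ j = 1 -> A *m (cyc_norm A j *m w) = cyc_norm A j *m w.
    by move=> Aj; rewrite -mulmx_mul mul_cyc_norm.
  apply: (@duality_core (q0 *: (U *+ m - h *+ (l * m)) + Nx *m g)
    (q0 *: (V *+ l - h *+ (l * m)) + Ny *m g) kap
    (- ((1 - Y) *m g)) (Nw *m - ((1 - Y) *m g))) => //.
  - move: XU; rewrite mulmxBl mul1mx => XU.
    rewrite mulmxDr N0 // -scalemxAr mulmxBr !mulmx_mulrnr.
    have -> : X *m U = U + (h + X *m h) *+ l.
      by rewrite -[LHS](subKr U) XU mulNrn opprK.
    rewrite /kap; move: (X *m h) (Nx *m g) => a b.
    by apply/matrixP => i j; rewrite !(mulmxnE, mxE); ring.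
  - move: YV; rewrite mulmxBl mul1mx => YV.
    rewrite mulmxDr N0 // -scalemxAr mulmxBr !mulmx_mulrnr.
    have -> : Y *m V = V + (h + Y *m h) *+ m.
      by rewrite -[LHS](subKr V) YV mulNrn opprK.
    rewrite /kap; move: (Y *m h) (Ny *m g) => a b.
    by apply/matrixP => i j; rewrite !(mulmxnE, mxE); ring.
  - rewrite !mulmxN; move: Eu; rewrite laplacianE /kap.
    move: (Nx *m g) (Ny *m g) (_ *m (Nw *m _)) => a b d /matrixP Eu.
    apply/matrixP => i j; move: (Eu i j); rewrite !(mulmxnE, mxE) => E.
    apply/eqP; rewrite -subr_eq0 -{}E; apply/eqP; ring.
  - by rewrite /kap -!scalemxAr hw scaler0.
apply/matrixP => i j; move/matrixP/(_ i j): k0; rewrite !mxE => /eqP.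
by rewrite mulf_eq0 mulrn_eq0 (negbTE q00) orbF !muln_eq0 !gtn_eqF //= => /eqP.
Qed.

(** The operator is [Q * rotation * Q]. It commutes with the symmetries because it is built from [X]
    and [Y]; a mirror symmetry preserves the Laplacian but negates the skew part of each moment. Its
    values are cycles and it kills face boundaries, so it acts on homology. *)
Theorem hodge_operator (h0 : 'cV[int]_n.+1) : harmonic h0 -> h0 != 0 ->
  exists B : 'M[int]_n.+1,
    [/\ forall S, S * X = X * S -> S * Y = Y * S -> S * B = B * S,
        forall S, S * X = X^T * S -> S * Y = Y^T * S -> S * B = - B * S,
        Nx * B = 0 /\ Ny * B = 0,
        B * (1 - Y^T) * Nw = 0 &
        forall j, B ^+ j <> 0].
Proof.
move=> harm_h0 h00; have [Q [q0 [R [q00 [Qs LQ] EQ commL commQ]]]] := harmonic_projector.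
have harmQ v : harmonic (Q *m v).
  by apply/harmonicP; rewrite -mulmx_mul LQ mul0mx.
exists (Q * rotation * Q); split.
- move=> S SX SY.
  have SXt : S * X^T = X^T * S.
    by rewrite -[S in RHS]mulr1 -mul_X_trX (mulrA S) SX !mulrA XX mul1r.
  have SYt : S * Y^T = Y^T * S.
    by rewrite -[S in RHS]mulr1 -mul_Y_trY (mulrA S) SY !mulrA YY mul1r.
  have SW : S * W = W * S by rewrite mulrA SY -mulrA SX mulrA.
  have S1Y : S * (1 - Y) = (1 - Y) * S by rewrite mulrBr mulrBl SY mulr1 mul1r.
  have S1Yt : S * (1 - Y^T) = (1 - Y^T) * S.
    by rewrite mulrBr mulrBl SYt mulr1 mul1r.
  have SL : S * laplacian = laplacian * S.
    rewrite /laplacian !(mulrDr S) !(mulrDl _ _ S).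
    rewrite (cyc_norm_commE _ SX) (cyc_norm_commE _ SY).
    by rewrite !mulrA S1Yt -(mulrA _ S) (cyc_norm_commE _ SW) -!mulrA S1Y.
  have SA : S * rotation = rotation * S.
    rewrite /rotation !cyc_moment_tr !mulrDr !mulrDl !mulrnAr !mulrnAl !mulrBr !mulrBl.
    by rewrite !(cyc_moment_commE _ SX, cyc_moment_commE _ SXt,
      cyc_moment_commE _ SY, cyc_moment_commE _ SYt).
  by rewrite -[RHS]mulrA -(commQ S) // !mulrA (commQ S) // -(mulrA Q S) SA !mulrA.
- move=> S SX SY.
  have SXt : S * X^T = X * S.
    by rewrite -[S in RHS]mulr1 -mul_X_trX (mulrA S) SX !mulrA mul_X_trX mul1r.
  have SYt : S * Y^T = Y * S.
    by rewrite -[S in RHS]mulr1 -mul_Y_trY (mulrA S) SY !mulrA mul_Y_trY mul1r.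
  have SW : S * W = (X * Y)^T * S.
    by rewrite [(_ * _)^T]trmx_mul mulrA SY -mulrA SX mulrA.
  have S1Y : S * (1 - Y) = (1 - Y^T) * S by rewrite mulrBr mulrBl SY mulr1 mul1r.
  have S1Yt : S * (1 - Y^T) = (1 - Y) * S by rewrite mulrBr mulrBl SYt mulr1 mul1r.
  (* The mirror turns the [Y X] cycles into cycles of the inverse of [X Y], which [Y] conjugates
     back to the original faces. *)
  have NXY : cyc_norm (X * Y)^T k = Y^T * Nw * Y.
    have E : Y * cyc_norm (X * Y) k = Nw * Y by apply: cyc_norm_commE; rewrite mulrA.
    have -> : cyc_norm (X * Y)^T k = (Y^T * (Nw * Y))^T.
      by rewrite -cyc_norm_tr -E mulrA YY mul1r.
    by rewrite [LHS]trmx_mul [X in X *m _]trmx_mul Nw_sym trmxK.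
  have SL : S * laplacian = laplacian * S.
    rewrite /laplacian !(mulrDr S) !(mulrDl _ _ S).
    rewrite (cyc_norm_commE _ SX) (cyc_norm_commE _ SY).
    rewrite -(cyc_norm_tr _ X) -(cyc_norm_tr _ Y) Nx_sym Ny_sym; congr (_ + _).
    have e1 : (1 - Y) * Y^T = - (1 - Y^T) by rewrite mulrBl mul1r mul_Y_trY opprB.
    have e2 : Y * (1 - Y^T) = - (1 - Y) by rewrite mulrBr mulr1 mul_Y_trY opprB.
    rewrite !mulrA S1Yt -(mulrA _ S) (cyc_norm_commE _ SW) NXY.
    by rewrite -!mulrA S1Y (mulrA Y) e2 !mulrA e1 !mulNr !mulrN !mulNr opprK.
  have SA : S * rotation = - rotation * S.
    rewrite /rotation !cyc_moment_tr mulrDr opprD mulrDl !mulrnAr -!mulNrn !mulrnAl.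
    rewrite !opprB !mulrBr !mulrBl.
    by rewrite !(cyc_moment_commE _ SX, cyc_moment_commE _ SXt,
      cyc_moment_commE _ SY, cyc_moment_commE _ SYt).
  rewrite !mulrA (commQ S) // -(mulrA Q S) SA !mulNr !mulrN !mulNr.
  by rewrite -!mulrA (commQ S).
- by split; apply: mx_eq0_cV => v; rewrite -mulrA !mulmx_mul;
     have [] := harmQ (rotation *m (Q *m v)).
- have Q0 : Nw * ((1 - Y) * Q) = 0.
    by apply: mx_eq0_cV => v; rewrite !mulmx_mul; have [] := harmQ v.
  rewrite -!mulrA; have -> : Q * ((1 - Y^T) * Nw) = 0; last by rewrite !mulr0.
  transitivity ((Nw * ((1 - Y) * Q))^T); last by rewrite Q0 trmx0.
  by rewrite [RHS]trmx_mul [X in X *m _]trmx_mul Qs Nw_sym trmx_1sub -mulmxA.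
(* On harmonic forms [Q] is the scalar [q0], so [rotation_duality] keeps the iterates of [h0]
   nonzero. *)
- move=> j Bj; suff: harmonic ((Q * rotation * Q) ^+ j *m h0) /\
      (Q * rotation * Q) ^+ j *m h0 != 0.
    by rewrite Bj mul0mx eqxx => -[].
  elim: j {Bj} => [|j [IH1 IH2]]; first by rewrite mul1mx.
  rewrite exprS mulmx_mul; move: (_ *m h0) IH1 IH2 => v harm_v v0.
  rewrite -mulrA 2!mulmx_mul; split=> //; apply: contra v0.
  have -> : Q *m v = q0 *: v.
    by rewrite EQ mulmxDl mul_scalar_mx commL mulmx_mul (harmonicP v).1 ?mulmx0 ?addr0.
  rewrite -!scalemxAr => /eqP Q0; apply/eqP; apply: (rotation_duality q00 EQ harm_v).
  apply/matrixP => i j'; move/matrixP/(_ i j'): Q0.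
  move: (Q *m _) => z; rewrite !mxE.
  by move/eqP; rewrite mulf_eq0 (negbTE q00) => /eqP.
Qed.

End Hodge.

(** * Roots modulo primes *)

Lemma poly_nonroot (P : {poly int}) (a : int) :
  P != 0 -> a != 0 -> exists t : nat, P.[a * t%:R] != 0.
Proof.
move=> P0 a0; pose s := [seq a * (i%:R : int) | i <- iota 0 (size P)].
have s_uniq : uniq s.
  rewrite map_inj_uniq ?iota_uniq // => i j /(mulfI a0) /eqP.
  by rewrite eqr_nat => /eqP.
have: ~~ all (root P) s.
  apply/negP => r; have := max_poly_roots P0 r s_uniq.
  by rewrite size_map size_iota ltnn.
by case/allPn => [_ /mapP[t _ ->] Pt]; exists t.
Qed.

(* Schur's argument: h(h(0) K t) / h(0) is congruent to 1 modulo K. *)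
Lemma schur_prime (h : {poly int}) (M : nat) :
  h.[0] != 0 -> (1 < size h)%N ->
  exists (p : nat) (t : int),
    [/\ prime p, (M < p)%N, (p %| h.[t])%Z & ~~ (p %| h.[0])%Z].
Proof.
move=> h0 sh; have [r Er] := poly_const_term h; set c := h.[0] in h0 Er *.
(* A prime that does not divide this factorial exceeds both [M] and the absolute value of [c], so it
   cannot divide [c]. *)
pose K := (maxn M `|c|)`!.
have K0 : (K%:Z != 0) by rewrite eqz_nat -lt0n fact_gt0.
have hc (e : int) : h - e%:P != 0.
  by rewrite -size_poly_gt0 size_polyDl ?size_polyN ?(leq_trans _ sh) //
    ltnS size_polyC_leq1.
(* Avoiding the values [0], [c] and [- c] forces [g] away from [0], [1] and [-1], so [g] has a prime
   divisor. *)
have [t] : exists t : nat,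
    (h * ((h - c%:P) * (h - (- c)%:P))).[c * K%:Z * t%:R] != 0.
  apply: poly_nonroot; last by rewrite mulf_neq0.
  by rewrite !mulf_neq0 // -size_poly_gt0 (leq_trans _ sh).
set x := c * _ * _; pose g : int := K%:Z * t%:R * r.[x] + 1.
have hx : h.[x] = c * g by rewrite Er !hornerE /x /g; ring.
rewrite !(hornerM, hornerD, hornerN, hornerC) hx.
have -> : c * g * ((c * g - c) * (c * g - - c)) = c ^+ 3 * (g * ((g - 1) * (g + 1))).
  by ring.
rewrite !mulf_eq0 !negb_or => /andP[_ /and3P[g0 g1 gN1]].
have g2 : (1 < `|g|)%N by lia.
have [p_pr pg] : prime (pdiv `|g|) /\ (pdiv `|g| %| g)%Z.
  by split; [exact: pdiv_prime | rewrite dvdzE pdiv_dvd].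
have pK : ~~ (pdiv `|g| %| K%:Z)%Z.
  apply/negP => pK; have : (pdiv `|g| %| g - K%:Z * t%:R * r.[x])%Z.
    by rewrite rpredB // -mulrA dvdz_mulr.
  by rewrite addrAC subrr add0r dvdz1 /=; move: (prime_gt1 p_pr); lia.
have Mp : (maxn M `|c| < pdiv `|g|)%N.
  by rewrite ltnNge; apply: contra pK => pM; rewrite dvdzE dvdn_fact // pM prime_gt0.
exists (pdiv `|g|), x; split=> //.
- exact: leq_ltn_trans (leq_maxl _ _) Mp.
- by rewrite hx dvdz_mull.
- apply/negP; rewrite dvdzE => /dvdn_leq; rewrite absz_gt0 h0 => /(_ isT).
  by rewrite leqNgt (leq_ltn_trans (leq_maxr _ _) Mp).
Qed.

Lemma intr_Fp_eq0 (p : nat) (c : int) :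
  prime p -> ((c%:~R : 'F_p) == 0) = (p %| c)%Z.
Proof.
by move=> pr; apply: esym; exact: dvdz_pcharf (pchar_Fp pr) c.
Qed.

(** Stripped of its powers of ['X], the characteristic polynomial is not constant, otherwise
    Cayley-Hamilton would make [B] nilpotent. A prime dividing [h.[t]] but not [h.[0]] makes [t] a
    nonzero eigenvalue modulo [p]. *)
Lemma modular_eigenvector (n : nat) (B : 'M[int]_n.+1) (M : nat) :
  (forall j, B ^+ j <> 0) ->
  exists p : nat, [/\ prime p, (M < p)%N &
    exists (c : 'F_p) (v : 'cV['F_p]_n.+1),
      [/\ c != 0, v != 0 & map_mx intr B *m v = c *: v]].
Proof.
move=> Bnil.
(* The transpose is used because [eigenvalue] concerns row vectors, whereas a column vector is
   wanted. *)
have [|s [h [Eh h0]]] := polyX_mult (p := char_poly B^T).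
  exact/monic_neq0/char_poly_monic.
have sh : (1 < size h)%N.
  rewrite ltnNge; apply/negP => /size1_polyC Ec; apply: (Bnil s).
  apply: trmx_inj; rewrite trmx_exp trmx0.
  have := Cayley_Hamilton B^T; rewrite Eh rmorphM rmorphXn /= horner_mx_X.
  rewrite Ec horner_mx_C [_ * _]mul_mx_scalar => /matrixP E.
  apply/matrixP => i j; move: (E i j); rewrite !mxE => /eqP.
  by rewrite mulf_eq0 => /orP[/eqP h00|/eqP//]; move: h0; rewrite Ec hornerC h00 eqxx.
have [p [t [p_pr Mp pt p0]]] := schur_prime M h0 sh.
exists p; split=> //; exists t%:~R.
have root_t : root (char_poly (map_mx (intr : int -> 'F_p) B^T)) t%:~R.
  rewrite -map_char_poly Eh rmorphM /= /root hornerM mulf_eq0.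
  by apply/orP; right; rewrite horner_map /= intr_Fp_eq0.
move: root_t; rewrite -eigenvalue_root_char => /eigenvalueP[v vB v0].
exists v^T; split.
- rewrite intr_Fp_eq0 //; apply: contra p0 => pt0.
  have [r Er] := poly_const_term h.
  have -> : h.[0] = h.[t] - t * r.[t].
    by rewrite {2}Er hornerD hornerM hornerX hornerC; ring.
  by rewrite rpredB // dvdz_mulr.
- by apply: contra v0 => /eqP/(congr1 trmx); rewrite trmxK trmx0 => ->.
- apply: trmx_inj; rewrite trmx_mul linearZ /= trmxK -vB.
  by congr (_ *m _); apply/matrixP => i j; rewrite !mxE.
Qed.

(** * Existence of harmonic forms *)

Section FunctionMatrices.
Variables (gT : finGroupType) (n : nat).
Hypothesis cardG : #|gT| = n.+1.

Definition gidx (g : gT) : 'I_n.+1 := cast_ord cardG (enum_rank g).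
Definition gelt (i : 'I_n.+1) : gT := enum_val (cast_ord (esym cardG) i).

Lemma gidxK : cancel gidx gelt.
Proof. by move=> g; rewrite /gelt /gidx cast_ordK enum_rankK. Qed.

Lemma geltK : cancel gelt gidx.
Proof. by move=> i; rewrite /gelt /gidx enum_valK cast_ordKV. Qed.

Variable R : nzRingType.

Definition basis (g : gT) : 'cV[R]_n.+1 := delta_mx (gidx g) 0.

Definition fun_mx (f : gT -> gT) : 'M[R]_n.+1 :=
  \matrix_(i, j) (i == gidx (f (gelt j)))%:R.

Lemma mulmx_basis m (A : 'M[R]_(m, n.+1)) g : A *m basis g = col (gidx g) A.
Proof. by rewrite colE. Qed.

Lemma fun_mx_basis f g : fun_mx f *m basis g = basis (f g).
Proof.
by rewrite mulmx_basis; apply/colP => i; rewrite !mxE gidxK eqxx andbT.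
Qed.

Lemma basis_ext m (A B : 'M[R]_(m, n.+1)) :
  (forall g, A *m basis g = B *m basis g) -> A = B.
Proof.
move=> AB; apply/matrixP => i j; move/colP/(_ i): (AB (gelt j)).
by rewrite !mulmx_basis !mxE geltK.
Qed.

Lemma fun_mxM f g : fun_mx f * fun_mx g = fun_mx (f \o g).
Proof. by apply: basis_ext => d; rewrite -mulmxA !fun_mx_basis. Qed.

Lemma fun_mx1 : fun_mx id = 1.
Proof. by apply: basis_ext => d; rewrite fun_mx_basis mul1mx. Qed.

Lemma eq_fun_mx f g : f =1 g -> fun_mx f = fun_mx g.
Proof. by move=> fg; apply/matrixP => i j; rewrite !mxE fg. Qed.

Lemma fun_mx_tr f g : cancel f g -> cancel g f -> (fun_mx f)^T = fun_mx g.
Proof.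
move=> fK gK; apply/matrixP => i j; rewrite !mxE; congr (_%:R); congr nat_of_bool.
apply/eqP/eqP => [->|->]; first by rewrite gidxK fK geltK.
by rewrite gidxK gK geltK.
Qed.

Definition rmul (a : gT) : gT -> gT := fun g => (g * a)%g.

Lemma rmul_exp a i : fun_mx (rmul a) ^+ i = fun_mx (rmul (a ^+ i)%g).
Proof.
elim: i => [|i IHi].
  by rewrite expr0 -fun_mx1; apply: eq_fun_mx => g; rewrite /rmul expg0 mulg1.
rewrite exprS IHi fun_mxM; apply: eq_fun_mx => g.
by rewrite /rmul /= expgSr mulgA.
Qed.

Lemma rmul_order a : fun_mx (rmul a) ^+ #[a]%g = 1.
Proof.
rewrite rmul_exp expg_order -fun_mx1; apply: eq_fun_mx => g.
by rewrite /rmul mulg1.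
Qed.

Lemma rmul_tr a : (fun_mx (rmul a))^T = fun_mx (rmul a^-1%g).
Proof.
by apply: fun_mx_tr => g; rewrite /rmul ?mulgK ?mulgKV.
Qed.

Lemma rmul_orthogonal a : (fun_mx (rmul a))^T * fun_mx (rmul a) = 1.
Proof.
rewrite rmul_tr fun_mxM -fun_mx1; apply: eq_fun_mx => g /=.
by rewrite /rmul mulgK.
Qed.

(** The order is reversed, which is why the faces, the cycles of [a * b], belong to [Y * X]. *)
Lemma rmulM a b : fun_mx (rmul b) * fun_mx (rmul a) = fun_mx (rmul (a * b)%g).
Proof. by rewrite fun_mxM; apply: eq_fun_mx => g /=; rewrite /rmul mulgA. Qed.

Lemma const_fun_mx f : const_mx 1 *m fun_mx f = const_mx 1 :> 'rV_n.+1.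
Proof.
apply/rowP => j; rewrite !mxE (bigD1 (gidx (f (gelt j)))) //= !mxE eqxx mul1r.
by rewrite big1 ?addr0 // => i /negbTE ij; rewrite !mxE ij mulr0.
Qed.

End FunctionMatrices.

Arguments basis {gT n} cardG R g.
Arguments fun_mx {gT n} cardG R f.

Lemma intr_fun_mx (gT : finGroupType) (n : nat) (cardG : #|gT| = n.+1)
    (R : nzRingType) f :
  map_mx intr (fun_mx cardG int f) = fun_mx cardG R f.
Proof. by apply/matrixP => i j; rewrite !mxE; case: (_ == _). Qed.

Lemma intr_cyc_norm (R : nzRingType) n (A : 'M[int]_n.+1) k :
  map_mx intr (cyc_norm A k) = cyc_norm (map_mx intr A : 'M[R]_n.+1) k.
Proof. by rewrite rmorph_sum; apply: eq_bigr => i _; rewrite rmorphXn. Qed.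

Section Rank.
Variables (gT : finGroupType) (n : nat) (cardG : #|gT| = n.+1).
Variable F : fieldType.
Local Notation fmx := (fun_mx cardG F).

Lemma rank_fun_mx f : (\rank (fmx f) <= #|f @: [set: gT]|)%N.
Proof.
pose I := f @: [set: gT].
pose A : 'M[F]_(n.+1, #|I|) := \matrix_(i, s) (i == gidx cardG (enum_val s))%:R.
pose B : 'M[F]_(#|I|, n.+1) := \matrix_(s, j) (f (gelt cardG j) == enum_val s)%:R.
suff -> : fmx f = A *m B by rewrite (leq_trans (mxrankM_maxr _ _)) ?rank_leq_row.
apply/matrixP => i j; rewrite !mxE.
have fI : f (gelt cardG j) \in I by apply: imset_f.
rewrite (bigD1 (enum_rank_in fI (f (gelt cardG j)))) //= !mxE.
rewrite enum_rankK_in // eqxx mulr1.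
rewrite big1 ?addr0 // => s sj; rewrite !mxE.
case: (f _ =P _) => [E|]; last by rewrite mulr0.
by case/eqP: sj; apply: enum_val_inj; rewrite enum_rankK_in.
Qed.

(** The norm takes equal values on the basis vectors of a left coset of [<[c]>], so it factors
    through a choice of coset representatives. *)
Lemma rank_cyc_norm (c : gT) :
  (\rank (cyc_norm (fmx (rmul c)) #[c]%g) <= #|[set: gT] : <[c]>|%g)%N.
Proof.
set N := cyc_norm _ _; pose rep g := repr (g *: <[c]>)%g.
have -> : N = N *m fmx rep.
  apply: (basis_ext (cardG := cardG)) => g; rewrite -mulmxA fun_mx_basis.
  have : rep g \in (g *: <[c]>)%g by apply: (mem_repr g); exact: lcoset_refl.
  case/lcosetP => _ /cycleP[i ->] ->.
  rewrite -[(g * c ^+ i)%g]/(rmul (c ^+ i)%g g) -fun_mx_basis -rmul_exp mulmxA.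
  congr (_ *m _); elim: i => [|i IHi]; first by rewrite mulmx1.
  rewrite exprS [_ *m _]mulrA cyc_norm_mul //; exact: rmul_order.
rewrite (leq_trans (mxrankM_maxr _ _)) // (leq_trans (rank_fun_mx _)) //.
rewrite -card_lcosets (_ : rep @: _ = repr @: lcosets <[c]>%g [set: gT]).
  exact: leq_imset_card.
by rewrite /lcosets -imset_comp; apply: eq_imset => g /=; rewrite /rep lcosetE.
Qed.
End Rank.

Lemma clear_denominators n (u : 'cV[rat]_n) :
  exists (z : 'cV[int]_n) (a : rat), a != 0 /\ map_mx intr z = a *: u.
Proof.
pose D := \prod_i denq (u i 0).
have D0 : D != 0 by apply/prodf_neq0 => i _; exact: denq_neq0.
exists (\col_i (numq (u i 0) * \prod_(j | j != i) denq (u j 0))), D%:~R.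
split; first by rewrite intr_eq0.
apply/colP => i; rewrite !mxE.
have -> : D = denq (u i 0) * \prod_(j | j != i) denq (u j 0) by rewrite /D (bigD1 i).
by rewrite !intrM numqE; ring.
Qed.

Section HarmonicExists.
Variables (gT : finGroupType) (n : nat) (cardG : #|gT| = n.+1).
Variables (a b : gT) (l m k : nat).
Hypotheses (oa : #[a]%g = l) (ob : #[b]%g = m) (oab : #[a * b]%g = k).
Hypothesis nonspherical : (l%:R^-1 + m%:R^-1 + k%:R^-1 : rat) <= 1.

Lemma index_cycle (c : gT) :
  ((#|[set: gT] : <[c]>|%g)%:R : rat) = n.+1%:R * (#[c]%g)%:R^-1.
Proof.
have o0 : ((#[c]%g)%:R : rat) != 0 by rewrite pnatr_eq0 -lt0n order_gt0.
rewrite -cardG -cardsT -(Lagrange (subsetT <[c]>%g)) natrM -orderE.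
by field.
Qed.

(** An Euler characteristic count: the all-ones row lies in both vertex row spaces, and also in that
    of [C], where [1 - Y] kills it. The equations therefore have rank at most the number of vertices
    and faces minus two, and [nonspherical] bounds that number by the number of edges. *)
Lemma harmonic_exists :
  exists h : 'cV[int]_n.+1,
    harmonic (fun_mx cardG int (rmul a)) (fun_mx cardG int (rmul b)) l m k h
    /\ h != 0.
Proof.
pose X := fun_mx cardG rat (rmul a); pose Y := fun_mx cardG rat (rmul b).
pose W := fun_mx cardG rat (rmul (a * b)%g).
pose A := cyc_norm X l; pose B := cyc_norm Y m; pose C := cyc_norm W k.
pose one : 'rV[rat]_n.+1 := const_mx 1.
have one0 : one != 0 by apply/eqP => /rowP/(_ 0); rewrite !mxE; apply/eqP/oner_neq0.
have oneN c : (one <= cyc_norm (fun_mx cardG rat (rmul c)) #[c]%g)%MS.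
  have o0 : ((#[c]%g)%:R : rat) != 0 by rewrite pnatr_eq0 -lt0n order_gt0.
  apply/submxP; exists ((#[c]%g)%:R^-1 *: one); rewrite -scalemxAl mulmx_sumr.
  rewrite (eq_bigr (fun=> one)); last by move=> i _; rewrite rmul_exp const_fun_mx.
  by rewrite sumr_const card_ord -scaler_nat scalerA mulVf // scale1r.
have rAB : (\rank (A + B)%MS + 1 <=
    #|[set: gT] : <[a]>|%g + #|[set: gT] : <[b]>|%g)%N.
  have cap1 : (1 <= \rank (A :&: B)%MS)%N.
    rewrite lt0n mxrank_eq0; apply: contra one0 => /eqP AB0.
    by rewrite -submx0 -AB0 sub_capmx /A /B -oa -ob !oneN.
  have := mxrank_sum_cap A B.
  have := rank_cyc_norm cardG rat a; have := rank_cyc_norm cardG rat b.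
  rewrite oa ob => rB rA E.
  by rewrite (leq_trans _ (leq_add rA rB)) // -E leq_add2l.
have rC : (\rank (C *m (1%:M - Y)) + 1 <= #|[set: gT] : <[(a * b)%g]>|%g)%N.
  have cap1 : (1 <= \rank (C :&: kermx (1%:M - Y))%MS)%N.
    rewrite lt0n mxrank_eq0; apply: contra one0 => /eqP AB0.
    rewrite -submx0 -AB0 sub_capmx /C -oab oneN /=; apply/sub_kermxP.
    by rewrite mulmxBr mulmx1 const_fun_mx subrr.
  have := mxrank_mul_ker C (1%:M - Y).
  have := rank_cyc_norm cardG rat (a * b)%g; rewrite oab => rC E.
  by rewrite (leq_trans _ rC) // -E leq_add2l.
have idx : (#|[set: gT] : <[a]>|%g + #|[set: gT] : <[b]>|%g
            + #|[set: gT] : <[(a * b)%g]>|%g <= n.+1)%N.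
  rewrite -(ler_nat rat) !natrD !index_cycle oa ob oab -!mulrDr.
  by rewrite ler_piMr // ler0n.
pose D := ((A + B) + C *m (1%:M - Y))%MS.
have rD : (\rank D < n.+1)%N.
  have : (\rank D <= \rank (A + B)%MS + \rank (C *m (1%:M - Y)))%N.
    by exact: mxrank_adds_leqif.
  lia.
have [j uj] : exists j, col j (cokermx D) != 0.
  apply/existsP; apply: contraLR rD; rewrite negb_exists => /forallP coker0.
  have c0 : cokermx D = 0.
    apply/matrixP => i j; move: (coker0 j); rewrite negbK => /eqP/colP/(_ i).
    by rewrite !mxE.
  have := mxrank_coker D; rewrite c0 mxrank0; have := rank_leq_row D; lia.
have Du : D *m col j (cokermx D) = 0.
  by rewrite colE mulmxA mulmx_coker mul0mx.
have kill p (E : 'M[rat]_(p, n.+1)) : (E <= D)%MS -> E *m col j (cokermx D) = 0.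
  by case/submxP => E' ->; rewrite -mulmxA Du mulmx0.
have [z [q [q0 zq]]] := clear_denominators (col j (cokermx D)).
have inj p : injective (map_mx intr : 'cV[int]_p -> 'cV[rat]_p).
  move=> x y /matrixP xy; apply/matrixP => i i'; move: (xy i i').
  by rewrite !mxE => /intr_inj.
exists z; split; last first.
  apply: contra uj => /eqP z0; move/eqP: zq; rewrite z0 map_mx0 eq_sym.
  by rewrite scaler_eq0 (negbTE q0).
have AD : (A <= D)%MS by rewrite (submx_trans (addsmxSl A B)) ?addsmxSl.
have BD : (B <= D)%MS by rewrite (submx_trans (addsmxSr A B)) ?addsmxSl.
split; apply: inj; rewrite !map_mxM map_mx0 zq -!scalemxAr.
- by rewrite intr_cyc_norm intr_fun_mx kill ?scaler0.
- by rewrite intr_cyc_norm intr_fun_mx kill ?scaler0.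
- rewrite intr_cyc_norm rmorphM rmorphB rmorph1 /= !intr_fun_mx rmulM mulmxA.
  by rewrite kill ?scaler0 // addsmxSr.
Qed.
End HarmonicExists.

(** * Covers by cocycles *)

Definition triple (G : groupType) (a b : G) : 'I_3 -> G :=
  ord3_case a b ((a * b)^-1)%g.

Section Shift.
Variables (gT : finGroupType) (V : finZmodType).

(** Elements of the wreath product of [V] by [gT]: lifts of right translation by [g] with voltage
    [phi]. A relation leaves [phi] free up to pointwise equality. *)
Definition shifts (g : gT) (phi : gT -> V) (P : {perm gT * V}) : Prop :=
  forall d v, P (d, v) = ((d * g)%g, v + phi d).

Lemma shift_subproof (g : gT) (phi : gT -> V) :
  injective (fun x : gT * V => ((x.1 * g)%g, x.2 + phi x.1)).
Proof.
move=> [d v] [d' v'] /= [/mulIg <-].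
by move/addIr <-.
Qed.

Definition shift g phi : {perm gT * V} := perm (@shift_subproof g phi).

Lemma shiftP g phi : shifts g phi (shift g phi).
Proof. by move=> d v; rewrite permE. Qed.

Lemma shifts1 : shifts 1 (fun=> 0) 1.
Proof. by move=> d v; rewrite perm1 mulg1 addr0. Qed.

Lemma shiftsM g h phi psi P Q : shifts g phi P -> shifts h psi Q ->
  shifts (g * h) (fun d => phi d + psi (d * g)%g) (P * Q)%g.
Proof. by move=> Pg Qh d v; rewrite permM Pg Qh mulgA addrA. Qed.

Lemma shiftsV g phi P : shifts g phi P ->
  shifts g^-1 (fun d => - phi (d * g^-1)%g) P^-1%g.
Proof.
move=> Pg d v; apply: (@perm_inj _ P); rewrite permKV Pg mulgKV.
by rewrite addrNK.
Qed.

Lemma eq_shifts g phi psi P : phi =1 psi -> shifts g phi P -> shifts g psi P.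
Proof. by move=> E Pg d v; rewrite Pg E. Qed.

Lemma shifts_exp g phi P k : shifts g phi P ->
  shifts (g ^+ k) (fun d => \sum_(i < k) phi (d * g ^+ i)%g) (P ^+ k)%g.
Proof.
move=> Pg; elim: k => [|k IHk].
  by rewrite !expg0; apply: eq_shifts shifts1 => d; rewrite big_ord0.
rewrite !expgSr; apply: eq_shifts (shiftsM IHk Pg) => d.
by rewrite big_ord_recr.
Qed.

Lemma shifts_order g phi P : shifts g phi P -> (P ^+ #[g] = 1)%g -> #[P]%g = #[g]%g.
Proof.
move=> Pg Pog; apply/eqP; rewrite eqn_dvd; apply/andP; split.
  by rewrite order_dvdn Pog.
rewrite order_dvdn; have := shifts_exp #[P]%g Pg 1%g 0.
by rewrite expg_order perm1 mul1g => -[<-].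
Qed.

(** The voltage collected along the path spelled by [w] from [d], as in Fox calculus; a generator
    walked backwards counts negatively, at the dart it arrives at. *)
Fixpoint cocycle (g : 'I_3 -> gT) (phi : 'I_3 -> gT -> V) (w : word 'I_3)
    (d : gT) : V :=
  if w is (i, s) :: w' then
    (if s then - phi i (d * (g i)^-1)%g else phi i d)
    + cocycle g phi w' (d * (if s then (g i)^-1 else g i))%g
  else 0.

Lemma cocycle_cat g phi u w d :
  cocycle g phi (u ++ w) d = cocycle g phi u d + cocycle g phi w (d * weval g u)%g.
Proof.
elim: u d => [|[i s] u IHu] d /=; first by rewrite /weval big_nil mulg1 add0r.
by rewrite IHu addrA /weval big_cons mulgA.
Qed.

Lemma shifts_weval g phi (P : 'I_3 -> {perm gT * V}) w :
  (forall i, shifts (g i) (phi i) (P i)) ->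
  shifts (weval g w) (cocycle g phi w) (weval P w).
Proof.
move=> Pg; elim: w => [|[i s] w IHw].
  by rewrite /weval !big_nil; exact: shifts1.
rewrite /weval !big_cons -/(weval g w) -/(weval P w) /=; apply: shiftsM IHw.
by case: s; [exact: shiftsV | exact: Pg].
Qed.

Lemma shifts_triple a b phi psi P Q : shifts a phi P -> shifts b psi Q ->
  forall i, shifts (triple a b i)
    (ord3_case phi psi (fun d => - (phi (d * (a * b)^-1)%g
      + psi (d * (a * b)^-1 * a)%g)) i) (triple P Q i).
Proof.
move=> Pa Qb i; rewrite /triple /ord3_case; case: ifP => _ //; case: ifP => _ //.
by apply: eq_shifts (shiftsV (shiftsM Pa Qb)) => d.
Qed.
End Shift.

(** Naturality, applied with [th] the identity, the mirror [sg], and left translations. *)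
Lemma cocycle_morph (gT : finGroupType) (V U : finZmodType) (L : {additive V -> U})
    (th : gT -> gT) (g g' : 'I_3 -> gT) phi phi' w d :
  (forall i d, th (d * g i)%g = (th d * g' i)%g) ->
  (forall i d, phi' i (th d) = L (phi i d)) ->
  cocycle g' phi' w (th d) = L (cocycle g phi w d).
Proof.
move=> thM phiE.
have thV i d' : th (d' * (g i)^-1)%g = (th d' * (g' i)^-1)%g.
  by apply: (mulIg (g' i)); rewrite -thM !mulgKV.
elim: w d => [|[i s] w IHw] d /=; first by rewrite raddf0.
rewrite raddfD /= -IHw; case: s; last by rewrite phiE thM.
by rewrite raddfN -phiE !thV.
Qed.

Lemma gen_weval (gT : finGroupType) (a b g : gT) :
  g \in <<[set a; b]>>%g -> exists w, weval (triple a b) w = g.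
Proof.
pose A := [set h : gT | `[< exists w, weval (triple a b) w = h >]].
have gA : group_set A.
  apply/group_setP; split=> [|h k]; rewrite !inE.
    by apply/asboolP; exists [::]; rewrite /weval big_nil.
  move=> /asboolP[u <-] /asboolP[w <-]; apply/asboolP.
  by exists (u ++ w); rewrite weval_cat.
move=> gG; suff: g \in Group gA by rewrite inE => /asboolP.
apply: (subsetP _ g gG); rewrite gen_subG; apply/subsetP => h.
by rewrite !inE => /orP[] /eqP ->; apply/asboolP;
  [exists (letter i0) | exists (letter i1)];
  rewrite weval_letter /triple /ord3_case ?eqxx ?i10.
Qed.

(** * Closed words and homology modulo p *)

Section Loops.
Variables (gT : finGroupType) (n : nat) (cardG : #|gT| = n.+1).
Variables (p : nat) (a b : gT).
Hypothesis gen : forall g, exists w, weval (triple a b) w = g.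
Local Notation F := 'F_p.
Local Notation e := (basis cardG F).
Local Notation X := (fun_mx cardG F (rmul a)).
Local Notation Y := (fun_mx cardG F (rmul b)).

(* The chain swept by a generator: x turns about the black vertex of d for free,
   y crosses from d to d * b through their white vertex. *)
Definition edge (i : 'I_3) (d : gT) : 'cV[F]_n.+1 :=
  ord3_case (fun=> 0) (fun d => e d - e (d * b)%g)
    (fun d => e d - e (d * b^-1)%g) i d.

Local Notation tau := (cocycle (triple a b) edge).

(* Loops form a subspace, so v is a loop as soon as no linear form separates it
   from them. *)
Lemma loops_span (v : 'cV[F]_n.+1) :
    (forall f : 'rV[F]_n.+1,
      (forall w, weval (triple a b) w = 1%g -> f *m tau w 1%g = 0) -> f *m v = 0) ->
  exists w, weval (triple a b) w = 1%g /\ tau w 1%g = v.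
Proof.
move=> dual.
pose loop (x : 'cV[F]_n.+1) := exists w, weval (triple a b) w = 1%g /\ tau w 1%g = x.
have loop0 : loop 0 by exists [::]; rewrite /weval big_nil.
have loopD x y : loop x -> loop y -> loop (x + y).
  move=> [u [u1 <-]] [w [w1 <-]]; exists (u ++ w).
  by rewrite weval_cat cocycle_cat u1 w1 mulg1.
(* Scalars of the prime field are iterated sums of [1], so closure under addition suffices. *)
have loopZ (c : F) x : loop x -> loop (c *: x).
  move=> lx; rewrite -[c]natr_Zp scaler_nat.
  by elim: (c : nat) => [|j IHj]; rewrite ?mulr0n // mulrS; exact: loopD.
pose M := \matrix_(i < #|{: 'cV[F]_n.+1}|)
  (if `[< loop (enum_val i) >] then (enum_val i)^T else 0).
have Mloop x : loop x -> (x^T <= M)%MS.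
  move=> lx; suff -> : x^T = row (enum_rank x) M by exact: row_sub.
  by rewrite rowK enum_rankK; case: asboolP.
have: (v^T <= M)%MS.
  rewrite submxE; apply/eqP/row_matrixP => i; rewrite row0.
  apply/rowP => j; rewrite [RHS]mxE.
  set f := col j (cokermx M).
  have fv : f^T *m v = 0.
    apply: dual => w w1; rewrite -[LHS]trmxK trmx_mul trmxK /f colE mulmxA.
    suff /eqP -> : (tau w 1%g)^T *m cokermx M == 0 by rewrite mul0mx trmx0.
    by rewrite -submxE; apply: Mloop; exists w.
  have: v^T *m f = 0 by rewrite -[LHS]trmxK trmx_mul trmxK fv trmx0.
  rewrite /f colE mulmxA -colE; move: (_ *m cokermx M) => N /colP/(_ i).
  by rewrite !mxE.
case/submxP => D /(congr1 trmx); rewrite trmxK mulmx_sum_row linear_sum => ->.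
elim/big_ind: _ => //= i _; rewrite linearZ /=; apply: loopZ; rewrite rowK /=.
by case: asboolP => [|_]; rewrite ?trmxK ?trmx0.
Qed.

(** Invariance makes the norm act on [r] as the scalar [k], which is invertible here. *)
Lemma rmul_invariant_norm (c : gT) k (r : 'rV[F]_n.+1) (v : 'cV[F]_n.+1) :
  r *m fun_mx cardG F (rmul c) = r ->
  cyc_norm (fun_mx cardG F (rmul c)) k *m v = 0 -> (k%:R : F) != 0 -> r *m v = 0.
Proof.
set Z := fun_mx _ _ _ => rZ Nv k0.
have: r *m cyc_norm Z k = k%:R *: r.
  rewrite mulmx_sumr (eq_bigr (fun=> r)) ?sumr_const ?card_ord ?scaler_nat //.
  move=> i _; elim: (i : nat) => [|j IHj]; first by rewrite mulmx1.
  by rewrite exprS [_ *m _]mulmxA rZ.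
move/(congr1 (mulmx^~ v)); rewrite -mulmxA Nv mulmx0 -scalemxAl => /esym/eqP.
by rewrite scaler_eq0 (negbTE k0) => /eqP.
Qed.

(** By duality: a form that kills all loops is the difference of a [Y]-invariant and an
    [X]-invariant form, and each of these kills [v]. *)
Lemma cycle_is_loop (v : 'cV[F]_n.+1) :
  ((#[a]%g)%:R : F) != 0 -> ((#[b]%g)%:R : F) != 0 ->
  cyc_norm X #[a]%g *m v = 0 -> cyc_norm Y #[b]%g *m v = 0 ->
  exists w, weval (triple a b) w = 1%g /\ tau w 1%g = v.
Proof.
move=> a0 b0 Xv Yv; apply: loops_span => f f0.
have [wd wdP] := choice gen.
have endpoint u w : weval (triple a b) u = weval (triple a b) w ->
    f *m tau u 1%g = f *m tau w 1%g.
  move=> uw; have [r rE] := gen (weval (triple a b) u)^-1%g.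
  have := f0 (u ++ r); have := f0 (w ++ r).
  rewrite !weval_cat !cocycle_cat -!uw rE mulgV !mul1g !mulmxDr.
  move=> /(_ erefl) wr /(_ erefl) ur;
  apply: (addIr (f *m tau r (weval (triple a b) u))).
  by rewrite wr ur.
(* f vanishes on loops, so it has a potential s; then s is constant around black
   vertices and s + f around white ones. *)
pose s h := f *m tau (wd h) 1%g.
have step h i : s (h * triple a b i)%g = s h + f *m edge i h.
  rewrite /s -[X in _ + f *m X]addr0 -mulmxDr.
  have -> : tau (wd h) 1%g + (edge i h + 0) = tau (wd h ++ letter i) 1%g.
    by rewrite cocycle_cat /= wdP mul1g.
  by apply: endpoint; rewrite weval_cat !wdP weval_letter.
pose r : 'rV[F]_n.+1 := \row_j (s (gelt cardG j)) 0 0.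
have rE h : r *m e h = s h.
  rewrite mulmx_basis; apply/matrixP => i j; rewrite !mxE gidxK.
  by rewrite [i]ord1 [j]ord1.
have rX : r *m X = r.
  apply: (basis_ext (cardG := cardG)) => h; rewrite -mulmxA fun_mx_basis !rE.
  by have := step h i0; rewrite /triple /edge /ord3_case eqxx mulmx0 addr0.
have rY : (r + f) *m Y = r + f.
  apply: (basis_ext (cardG := cardG)) => h; rewrite -mulmxA fun_mx_basis !mulmxDl !rE.
  have := step h i1; rewrite /triple /edge /ord3_case i10 eqxx mulmxBr => ->.
  by rewrite addrA addrNK.
have rv := rmul_invariant_norm rX Xv a0.
by have := rmul_invariant_norm rY Yv b0; rewrite mulmxDl rv add0r.
Qed.
End Loops.

Section Cover.
Variables (gT : finGroupType) (n : nat) (cardG : #|gT| = n.+1).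
Variables (p : nat) (a b : gT) (C : 'M['F_p]_n.+1).
Local Notation F := 'F_p.
Local Notation V := ('cV[F]_n.+1 : finZmodType).
Local Notation e := (basis cardG F).
Local Notation X := (fun_mx cardG F (rmul a)).
Local Notation Y := (fun_mx cardG F (rmul b)).
Local Notation tau := (cocycle (triple a b) (edge cardG p b)).

(** The cover with voltages in homology: a closed word moves the fibre over [d] by [C] applied to
    its chain from [d], so it acts trivially exactly when [C] kills all these chains. *)
Definition cover_a : {perm gT * V} := shift a (fun=> 0 : V).
Definition cover_b : {perm gT * V} :=
  shift b (fun d => C *m (e d - e (d * b)%g) : V).

Lemma shifts_cover i :
  shifts (triple a b i) (fun d => C *m edge cardG p b i d : V)
    (triple cover_a cover_b i).
Proof.
have Pa : shifts a (fun=> 0) cover_a by exact: shiftP.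
have Pb : shifts b (fun d => C *m (e d - e (d * b)%g) : V) cover_b by exact: shiftP.
apply: eq_shifts (shifts_triple Pa Pb i) => d.
rewrite /edge /ord3_case; case: ifP => _; first by rewrite mulmx0.
case: ifP => _ //; rewrite add0r invMg !mulgA !mulgKV.
by rewrite -mulmxN opprB.
Qed.

Lemma cover_weval w :
  shifts (weval (triple a b) w) (fun d => C *m tau w d : V)
    (weval (triple cover_a cover_b) w).
Proof.
apply: eq_shifts (shifts_weval w shifts_cover) => d.
exact: (cocycle_morph (L := mulmx C) (th := id)).
Qed.

Lemma order_cover_a : #[cover_a]%g = #[a]%g.
Proof.
apply: (@shifts_order _ _ _ (fun=> 0)); first exact: shiftP.
have := shifts_exp #[a]%g (shiftP a (fun=> 0 : V)) => E.
by apply/permP => -[d v]; rewrite E perm1 expg_order mulg1 big1 // addr0.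
Qed.

Lemma order_cover_b : #[cover_b]%g = #[b]%g.
Proof.
apply: (@shifts_order _ _ _ (fun d => C *m (e d - e (d * b)%g))); first exact: shiftP.
have := shifts_exp #[b]%g (shiftP b (fun d => C *m (e d - e (d * b)%g) : V)) => E.
apply/permP => -[d v]; rewrite E perm1 expg_order mulg1 -mulmx_sumr.
suff -> : \sum_(i < #[b]%g) (e (d * b ^+ i)%g - e (d * b ^+ i * b)%g) = 0.
  by rewrite mulmx0 addr0.
suff E' k : \sum_(i < k) (e (d * b ^+ i)%g - e (d * b ^+ i * b)%g) =
    e d - e (d * b ^+ k)%g.
  by rewrite E' expg_order mulg1 subrr.
elim: k => [|k IHk]; first by rewrite big_ord0 expg0 mulg1 subrr.
by rewrite big_ord_recr /= IHk expgSr mulgA addrA addrNK.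
Qed.

(** The voltage collected around a face is [C] applied to minus its boundary [(1 - Y^T) N e], which
    the hypothesis annihilates. *)
Lemma order_cover_ab :
  C * (1 - Y^T) * cyc_norm (Y * X) #[a * b]%g = 0 ->
  #[cover_a * cover_b]%g = #[a * b]%g.
Proof.
move=> CN; pose phi d : V := C *m (e (d * a)%g - e (d * a * b)%g).
have Pab : shifts (a * b)%g phi (cover_a * cover_b)%g.
  have := shiftsM (shiftP a (fun=> 0 : V))
    (shiftP b (fun d => C *m (e d - e (d * b)%g) : V)).
  by apply: eq_shifts => d; rewrite add0r.
apply: (shifts_order Pab); apply/permP => -[d v].
rewrite (shifts_exp _ Pab) perm1 expg_order mulg1 -mulmx_sumr.
set N := cyc_norm _ _ in CN.
have Wk : (Y * X) ^+ #[a * b]%g = 1 by rewrite rmulM rmul_order.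
have Nd : N *m e d = \sum_(i < #[a * b]%g) e (d * (a * b) ^+ i * a * b)%g.
  rewrite /N -(mul_cyc_norm Wk) /cyc_norm mulr_sumr mulmx_suml.
  apply: eq_bigr => i _; rewrite -exprS rmulM rmul_exp.
  by rewrite fun_mx_basis /rmul expgSr !mulgA.
suff -> : \sum_(i < #[a * b]%g) (e (d * (a * b) ^+ i * a)%g
      - e (d * (a * b) ^+ i * a * b)%g) = - ((1 - Y^T) *m (N *m e d)).
  by rewrite mulmxN !mulmxA [C *m _ *m N]CN mul0mx oppr0 addr0.
rewrite Nd mulmx_sumr -sumrN; apply: eq_bigr => i _.
by rewrite mulmxBl mul1mx rmul_tr fun_mx_basis /rmul mulgK opprB.
Qed.
End Cover.

Section InvertedCover.
Variables (gT : finGroupType) (n : nat) (cardG : #|gT| = n.+1).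
Variables (p : nat) (a b : gT) (C : 'M['F_p]_n.+1) (sg : gT -> gT).
Hypotheses (sgM : {morph sg : g h / (g * h)%g}) (sgK : involutive sg).
Hypotheses (sga : sg a = a^-1%g) (sgb : sg b = b^-1%g).
Local Notation F := 'F_p.
Local Notation V := ('cV[F]_n.+1 : finZmodType).
Local Notation e := (basis cardG F).
Local Notation S := (fun_mx cardG F sg).
Local Notation tau := (cocycle (triple a b) (edge cardG p b)).
Local Notation A := (cover_a n p a).
Local Notation B := (cover_b cardG b C).

Lemma sgV g : sg g^-1%g = (sg g)^-1%g.
Proof.
have sg1 : sg 1%g = 1%g by apply: (mulgI (sg 1%g)); rewrite -sgM !mulg1.
by apply: (mulgI (sg g)); rewrite -sgM !mulgV sg1.
Qed.

Lemma sg_triple i : sg (triple a b i) = triple a^-1%g b^-1%g i.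
Proof.
rewrite /triple /ord3_case; case: ifP => _ //; case: ifP => _ //.
by rewrite sgV sgM sga sgb.
Qed.

Lemma shifts_inverted i :
  shifts (triple a^-1 b^-1 i)%g (fun d => C *m (S *m edge cardG p b i (sg d)) : V)
    (triple A^-1 B^-1 i)%g.
Proof.
have Pa := shiftsV (shiftP a (fun=> 0 : V)).
have Pb := shiftsV (shiftP b (fun d => C *m (e d - e (d * b)%g) : V)).
apply: eq_shifts (shifts_triple Pa Pb i) => d.
rewrite /edge /ord3_case; case: ifP => _; first by rewrite !mulmx0 oppr0.
case: ifP => _; rewrite [S *m _]mulmxBr !fun_mx_basis sgM ?sgV sgK sgb.
  by rewrite mulgKV -mulmxN opprB.
by rewrite oppr0 add0r opprK invMg !invgK !mulgA !mulgK.
Qed.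

(** In the mirror image of the cover, a loop with chain [v] at the identity acts there through
    [C *m (S *m v)] instead of [C *m v]. *)
Lemma inverted_weval w :
  shifts (weval (triple a^-1 b^-1)%g w) (fun d => C *m (S *m tau w (sg d)) : V)
    (weval (triple A^-1 B^-1)%g w).
Proof.
apply: eq_shifts (shifts_weval w shifts_inverted) => d.
have := @cocycle_morph gT V V (mulmx C \o mulmx S) sg (triple a b)
  (triple a^-1 b^-1)%g (edge cardG p b)
  (fun i d => C *m (S *m edge cardG p b i (sg d))) w (sg d).
rewrite sgK; apply.
  by move=> i d'; rewrite sgM sg_triple.
by move=> i d'; rewrite sgK.
Qed.
End InvertedCover.

Theorem chiral_cover (gT : finGroupType) (a b : gT) (sg : gT -> gT) (l m k : nat) :
    (forall g, exists w, weval (triple a b) w = g) ->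
    #[a]%g = l -> #[b]%g = m -> #[a * b]%g = k ->
    (l%:R^-1 + m%:R^-1 + k%:R^-1 : rat) <= 1 ->
    {morph sg : g h / (g * h)%g} -> involutive sg ->
    sg a = a^-1%g -> sg b = b^-1%g ->
  exists (Q : finGroupType) (a' b' : Q),
    [/\ #[a']%g = l, #[b']%g = m, #[a' * b']%g = k,
        forall w, weval (triple a' b') w = 1%g -> weval (triple a b) w = 1%g &
        exists w, weval (triple a' b') w = 1%g /\
                  weval (triple a'^-1 b'^-1)%g w <> 1%g].
Proof.
move=> gen oa ob oab nonsph sgM sgK sga sgb.
have [n cardG] : exists n, #|gT| = n.+1.
  by exists #|gT|.-1; rewrite prednK // -cardsT cardG_gt0.
have [h0 [harm_h0 h00]] := harmonic_exists cardG oa ob oab nonsph.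
have l0 : (0 < l)%N by rewrite -oa order_gt0.
have m0 : (0 < m)%N by rewrite -ob order_gt0.
have k0 : (0 < k)%N by rewrite -oab order_gt0.
set X := fun_mx cardG int (rmul a) in harm_h0.
set Y := fun_mx cardG int (rmul b) in harm_h0.
have XX : X^T * X = 1 by exact: rmul_orthogonal.
have YY : Y^T * Y = 1 by exact: rmul_orthogonal.
have Xl : X ^+ l = 1 by rewrite -oa rmul_order.
have Ym : Y ^+ m = 1 by rewrite -ob rmul_order.
have Wk : (Y * X) ^+ k = 1 by rewrite rmulM -oab rmul_order.
have [D [Dcomm Danti [XD YD] DW Dnil]] :=
  hodge_operator l0 m0 k0 XX YY Xl Ym Wk harm_h0 h00.
(* The bound makes [l], [m] and [2] invertible modulo [p]: the first two for [cycle_is_loop], the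
   last for the factor [2] in [CSv]. *)
have [p [p_pr pM [c [v [c0 v0 Dv]]]]] := modular_eigenvector (l + m + 2) Dnil.
pose DF : 'M['F_p]_n.+1 := map_mx intr D.
have natF j : (0 < j < p)%N -> (j%:R : 'F_p) != 0.
  case/andP => j0 jp; rewrite -(dvdn_pcharf (pchar_Fp p_pr)).
  by apply/negP => /(dvdn_leq j0); rewrite leqNgt jp.
have intrK (f : gT -> gT) : map_mx intr (fun_mx cardG int f) = fun_mx cardG 'F_p f.
  exact: intr_fun_mx.
(* As [c] is nonzero, [v] lies in the image of [DF] and inherits what annihilates that image. *)
have kill_v (f : gT -> gT) j : cyc_norm (fun_mx cardG int f) j * D = 0 ->
    cyc_norm (fun_mx cardG 'F_p f) j *m v = 0.
  move=> ND; apply/eqP; have: c *: (cyc_norm (fun_mx cardG 'F_p f) j *m v) == 0.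
    rewrite scalemxAr -Dv mulmxA -intrK -intr_cyc_norm -map_mxM.
    by rewrite [X in map_mx _ X]ND map_mx0 mul0mx.
  by rewrite scaler_eq0 (negbTE c0).
(* The factor DF makes C a family of closed forms, so that the cover keeps the
   relation z^n; C kills the c-eigenspace of DF but not the (-c)-eigenspace. *)
pose C := (DF - c%:M) * DF.
have [w [w1 wv]] : exists w, weval (triple a b) w = 1%g /\
    cocycle (triple a b) (edge cardG p b) w 1%g = v.
  apply: cycle_is_loop; rewrite ?oa ?ob //; try exact: kill_v.
    by apply: natF; lia.
  by apply: natF; lia.
pose SF := fun_mx cardG 'F_p sg.
have SS : SF * SF = 1.
  by rewrite fun_mxM -(fun_mx1 cardG); apply: eq_fun_mx => g /=; rewrite sgK.
have SD : SF * DF = - DF * SF.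
  have: fun_mx cardG int sg * D = - D * fun_mx cardG int sg.
    by apply: Danti; rewrite rmul_tr !fun_mxM; apply: eq_fun_mx => g /=;
       rewrite /rmul sgM ?sga ?sgb.
  by move/(congr1 (map_mx (intr : int -> 'F_p))); rewrite !rmorphM rmorphN /= !intrK.
have Cv : C *m v = 0.
  by rewrite /C -mulmxA Dv -scalemxAr mulmxBl Dv mul_scalar_mx subrr scaler0.
(* [SF *m v] has eigenvalue [- c], so [C] multiplies it by [(- c - c) * (- c)]. *)
have CSv : C *m (SF *m v) = (c ^+ 2 *+ 2) *: (SF *m v).
  have DSv : DF *m (SF *m v) = - c *: (SF *m v).
    rewrite mulmxA -[DF *m SF]opprK -[DF *m SF]/(DF * SF) -mulNr -SD.
    by rewrite mulNmx -mulmxA Dv -scalemxAr scaleNr.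
  rewrite /C -mulmxA DSv -scalemxAr mulmxBl DSv mul_scalar_mx -scalerBl scalerA.
  by congr (_ *: _); ring.
exists {perm gT * ('cV['F_p]_n.+1 : finZmodType)}, (cover_a n p a),
  (cover_b cardG b C).
split.
- by rewrite order_cover_a.
- by rewrite order_cover_b.
- rewrite order_cover_ab //; rewrite oab.
  have := congr1 (map_mx (intr : int -> 'F_p)) DW.
  rewrite !rmorphM rmorphB rmorph1 /= map_mx0 intr_cyc_norm rmorphM /= !intrK.
  rewrite rmul_tr intrK -rmul_tr => DW'.
  by rewrite /C -!mulrA; rewrite -!mulrA in DW'; rewrite DW' mulr0.
- move=> u u1; have := cover_weval cardG a b C u 1%g 0.
  by rewrite u1 perm1 mul1g => -[<-].
- exists w; split.
    apply/permP => -[d x]; rewrite cover_weval perm1 w1 mulg1.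
    (* Seen from the dart [d], the loop [w] has the left translate of [v] as its chain. Left
       translations commute with [C], so [w] fixes every fibre. *)
    pose Ld := fun_mx cardG 'F_p (fun g => d * g)%g.
    have LD : Ld * DF = DF * Ld.
      have: fun_mx cardG int (fun g => d * g)%g * D =
          D * fun_mx cardG int (fun g => d * g)%g.
        by apply: Dcomm; rewrite !fun_mxM; apply: eq_fun_mx => g /=;
           rewrite /rmul mulgA.
      by move/(congr1 (map_mx (intr : int -> 'F_p))); rewrite !rmorphM /= !intrK.
    have -> : cocycle (triple a b) (edge cardG p b) w d = Ld *m v.
      rewrite -wv -[in LHS](mulg1 d).
      apply: (@cocycle_morph gT _ _ (mulmx Ld) (fun g => d * g)%g) => i g.
        by rewrite mulgA.
      rewrite /edge /ord3_case; case: ifP => _ /=; first by rewrite mulmx0.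
      by case: ifP => _; rewrite mulmxBr !fun_mx_basis !mulgA.
    suff -> : C *m (Ld *m v) = 0 by rewrite addr0.
    rewrite mulmxA; have -> : C *m Ld = Ld *m C; last by rewrite -mulmxA Cv mulmx0.
    have cL : c%:M * Ld = Ld * c%:M.
      by apply: etrans (mul_scalar_mx _ _) _; exact/esym/mul_mx_scalar.
    rewrite -[LHS]/(C * Ld) -[RHS]/(Ld * C) /C -mulrA -LD !mulrA mulrBl mulrBr LD.
    by rewrite cL.
  have := inverted_weval cardG C sgM sgK sga sgb w 1%g 0.
  move=> E w1'; move: E; rewrite w1' perm1 => -[_].
  have sg1 : sg 1%g = 1%g by rewrite -[in LHS](mulgV a) sgM (sgV sgM) mulgV.
  rewrite sg1 wv CSv add0r => /esym/eqP.
  rewrite scaler_eq0 => /orP[|/eqP Sv0].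
    rewrite -mulr_natr mulf_eq0 expf_eq0 (negbTE c0) /=; apply/negP/natF; lia.
  have SSv : SF *m (SF *m v) = v by rewrite mulmxA [SF *m SF]SS mul1mx.
  by move: v0; rewrite -SSv Sv0 mulmx0 eqxx.
Qed.

(** * Words and hypermaps *)

Local Open Scope group_scope.
Local Open Scope quotient_scope.

Lemma morph_one (G K : groupType) (phi : G -> K) :
  {morph phi : g h / g * h} -> phi 1 = 1.
Proof. by move=> phiM; apply: (mulgI (phi 1)); rewrite -phiM !mulg1. Qed.

Lemma morph_weval (X : choiceType) (G K : groupType) (phi : G -> K) (f : X -> G) w :
  {morph phi : g h / g * h} -> phi (weval f w) = weval (phi \o f) w.
Proof.
move=> phiM; have phi1 := morph_one phiM.
have phiV g : phi g^-1 = (phi g)^-1 by apply: (mulgI (phi g)); rewrite -phiM !mulgV.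
elim: w => [|[a s] w IHw]; first by rewrite /weval !big_nil.
by rewrite /weval !big_cons phiM -/(weval f w) IHw; case: s; rewrite /= ?phiV.
Qed.

Lemma eq_weval (X : choiceType) (G : groupType) (f g : X -> G) w :
  f =1 g -> weval f w = weval g w.
Proof. by move=> fg; apply: eq_bigr => a _; rewrite fg. Qed.

Lemma morph_triple (G K : groupType) (phi : G -> K) a b i :
  {morph phi : g h / g * h} -> phi (triple a b i) = triple (phi a) (phi b) i.
Proof.
move=> phiM; have phi1 := morph_one phiM.
rewrite /triple /ord3_case; case: ifP => _ //; case: ifP => _ //.
by apply: (mulgI (phi (a * b))); rewrite -phiM !mulgV phi1 phiM mulgV.
Qed.

Lemma morph_weval_triple (G K : groupType) (phi : G -> K) a b w :
  {morph phi : g h / g * h} ->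
  phi (weval (triple a b) w) = weval (triple (phi a) (phi b)) w.
Proof.
by move=> phiM; rewrite morph_weval //; apply: eq_weval => i; exact: morph_triple.
Qed.

Lemma triple_rels (G : groupType) (a b : G) l m n :
  a ^+ l = 1 -> b ^+ m = 1 -> (a * b) ^+ n = 1 ->
  forall r, r \in triangle_rels l m n -> weval (triple a b) r = 1.
Proof.
move=> al bm abn r; rewrite !inE; case/or4P => /eqP->;
  rewrite ?weval_cat ?weval_pow !weval_letter /triple /ord3_case ?eqxx ?i10 ?i20 ?i21 //.
- by rewrite expVgn abn invg1.
- by rewrite mulgA mulgV.
Qed.

(* Conjugation by r_2, read on words in x, y, z. *)
Definition flip_letter (t : 'I_3 * bool) : word 'I_3 :=
  if t.1 == i2 then
    if t.2 then [:: (i0, true); (i1, true)] else [:: (i1, false); (i0, false)]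
  else [:: (t.1, ~~ t.2)].

Definition flip (w : word 'I_3) : word 'I_3 := flatten (map flip_letter w).

Lemma weval_flip (G : groupType) (a b : G) w :
  weval (triple a b) (flip w) = weval (triple a^-1 b^-1) w.
Proof.
elim: w => [|[i s] w IHw]; first by rewrite /weval !big_nil.
rewrite /flip /= weval_cat IHw [RHS]/weval big_cons; congr (_ * _).
rewrite /flip_letter /=; case: (ord3P i) => ->; case: s;
  rewrite ?eqxx ?[i0 == i2]eq_sym ?[i1 == i2]eq_sym ?i20 ?i21 /weval ?big_cons ?big_nil;
  rewrite /triple /ord3_case /= ?eqxx ?i10 ?i20 ?i21 ?mulg1 ?invgK //.
by rewrite invMg !invgK.
Qed.

Definition hol (H : hypermap) (w : word 'I_3) : {perm dart H} :=
  weval (triple (hx H) (hy H)) w.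

Lemma hzE (H : hypermap) : hz H = (hx H * hy H)^-1.
Proof. by apply: (mulgI (hx H * hy H)); rewrite hypermap_xyz mulgV. Qed.

Lemma hx_hy_order l m n (H : hypermap) :
  has_type l m n H -> #[hx H] = l /\ #[hy H] = m /\ #[hx H * hy H] = n.
Proof. by case=> -> -> <-; rewrite hzE orderV. Qed.

Lemma monodromyE l m n (H : hypermap) w :
  has_type l m n H -> monodromy l m n H (\pi_(presented _) w) = hol H w.
Proof.
move=> HT; have [hl [hm hn]] := hx_hy_order HT.
rewrite /monodromy hzE; apply: pliftE; apply: triple_rels.
- by rewrite -hl expg_order.
- by rewrite -hm expg_order.
- by rewrite -hn expg_order.
Qed.

Lemma inj_morph_order (G K : finGroupType) (phi : G -> K) g :
  {morph phi : g h / g * h} -> injective phi -> #[phi g] = #[g].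
Proof.
move=> phiM phiI; have phi1 := morph_one phiM.
have phiX k : phi (g ^+ k) = phi g ^+ k.
  by elim: k => [|k IHk]; rewrite ?expg0 // !expgS phiM IHk.
apply/eqP; rewrite eqn_dvd !order_dvdn -phiX expg_order phi1 eqxx /=.
by apply/eqP/phiI; rewrite phiX expg_order phi1.
Qed.

(** * Regular hypermaps from generating pairs *)

Section Generated.
Variables (Q : finGroupType) (a b : Q).
Local Notation G := <<[set a; b]>>%G.

(** The darts of a regular hypermap will be all elements of a type, so the subgroup generated by [a]
    and [b] has to become a type of its own. *)
Lemma generated_subgroup :
  exists (gT : finGroupType) (a0 b0 : gT) (iota : gT -> Q),
    [/\ {morph iota : g h / g * h}, injective iota, iota a0 = a, iota b0 = b &
        forall g, exists w, weval (triple a0 b0) w = g].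
Proof.
have aG : a \in G by rewrite mem_gen // !inE eqxx.
have bG : b \in G by rewrite mem_gen // !inE eqxx orbT.
exists (subg_of G), (subg G a), (subg G b), (@sgval Q G); split.
- by [].
- exact: subg_inj.
- exact: subgK.
- exact: subgK.
- move=> g; have [w wg] := gen_weval (valP g); exists w; apply: subg_inj.
  by rewrite morph_weval_triple // !subgK.
Qed.
End Generated.

Section Regular.
Variables (gT : finGroupType) (a b : gT).
Hypothesis gen : forall g, exists w, weval (triple a b) w = g.

Definition rperm (g : gT) : {perm gT} := perm (mulIg g).

Lemma rpermM : {morph rperm : g h / g * h}.
Proof. by move=> g h; apply/permP => x; rewrite permM !permE mulgA. Qed.

Lemma rperm_inj : injective rperm.
Proof. by move=> g h /permP/(_ 1); rewrite !permE !mul1g. Qed.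

Lemma regular_xyz : rperm a * rperm b * rperm (a * b)^-1 = 1.
Proof.
by rewrite -!rpermM mulgV; apply/permP => x; rewrite permE perm1 mulg1.
Qed.

Lemma regular_trans :
  [transitive <<[set rperm a; rperm b; rperm (a * b)^-1]>>, on [set: gT] | 'P].
Proof.
apply/imsetP; exists 1; rewrite ?inE //; apply/esym/setP => g; rewrite inE.
apply/orbitP; have [w wg] := gen g; exists (rperm g).
  rewrite -wg morph_weval; last exact: rpermM.
  rewrite /weval; apply: group_prod => -[i s] _ /=.
  have : rperm (triple a b i) \in <<[set rperm a; rperm b; rperm (a * b)^-1]>>.
    rewrite mem_gen // !inE /triple /ord3_case; case: ifP; rewrite ?eqxx //.
    by case: ifP; rewrite eqxx ?orbT.
  by case: s => //; rewrite groupV.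
by rewrite /= apermE permE mul1g.
Qed.

Definition regular_hypermap : hypermap :=
  @Hypermap gT (rperm a) (rperm b) (rperm (a * b)^-1) regular_xyz regular_trans.

Lemma regular_type :
  has_type #[a] #[b] #[a * b] regular_hypermap.
Proof.
split=> /=; rewrite inj_morph_order ?orderV //; exact: rpermM || exact: rperm_inj.
Qed.

Lemma regular_regular : orientably_regular regular_hypermap.
Proof.
move=> d d'; exists (fun x : gT => d' * d^-1 * x); last by rewrite mulgKV.
split.
- by exists (fun x : gT => (d' * d^-1)^-1 * x) => x; rewrite ?mulKg ?mulKVg.
- by move=> x; rewrite /= !permE mulgA.
- by move=> x; rewrite /= !permE mulgA.
- by move=> x; rewrite /= !permE mulgA.
Qed.

Lemma regular_hol w :
  hol regular_hypermap w = 1 <-> weval (triple a b) w = 1.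
Proof.
have rperm1 : rperm 1 = 1 by apply/permP => x; rewrite permE perm1 mulg1.
rewrite /hol /= -morph_weval_triple; last exact: rpermM.
by rewrite -rperm1; split=> [/rperm_inj|->].
Qed.
End Regular.

(** The subgroup generated by [(x, x^-1)] and [(y, y^-1)] is the quotient by the intersection of the
    kernel with its mirror image, and exchanging the coordinates is the automorphism [sg]. *)
Lemma chiral_cover_hol l m n (H : hypermap) :
    ((l%:R^-1 + m%:R^-1 + n%:R^-1 : rat) <= 1)%R -> has_type l m n H ->
  exists K : hypermap,
    [/\ has_type l m n K, orientably_regular K,
        forall w, hol K w = 1 -> hol H w = 1 /\ hol H (flip w) = 1 &
        exists w, hol K w = 1 /\ hol K (flip w) <> 1].
Proof.
move=> nonsph HT; have [hl [hm hn]] := hx_hy_order HT.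
pose x := hx H; pose y := hy H.
have [gT [a [b [iota [iM iI ia ib gen]]]]] :=
  @generated_subgroup ({perm dart H} * {perm dart H})%type (x, x^-1) (y, y^-1).
pose swap (u : {perm dart H} * {perm dart H}) := (u.2, u.1).
have swapM : {morph swap : u v / u * v} by [].
have ex_sg g : exists g', iota g' = swap (iota g).
  have [w <-] := gen g; exists (weval (triple a^-1 b^-1) w).
  rewrite !morph_weval_triple // ia ib.
  have inv u u' : iota u = (u', u'^-1) -> iota u^-1 = swap (iota u).
    move=> E; apply: (mulgI (iota u)); rewrite -iM mulgV E.
    have i1 := morph_one iM.
    by rewrite i1; congr (_, _); rewrite /= ?mulgV ?mulVg.
  by rewrite (inv _ _ ia) (inv _ _ ib) ia ib.
have [sg sgE] := choice ex_sg.
have sgM : {morph sg : g h / g * h}.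
  by move=> g h; apply: iI; rewrite iM !sgE iM swapM.
have sgK : involutive sg by move=> g; apply: iI; rewrite !sgE; case: (iota g).
have sg_inv u u' : iota u = (u', u'^-1) -> sg u = u^-1.
  move=> E; apply: (mulgI u); apply: iI; rewrite mulgV iM sgE E.
  have i1 := morph_one iM.
  by rewrite i1; congr (_, _); rewrite /= ?mulgV ?mulVg.
have pair_exp (G K : finGroupType) (u : G) (v : K) k : (u, v) ^+ k = (u ^+ k, v ^+ k).
  by elim: k => [|k IHk]; rewrite ?expg0 // !expgS IHk.
have pair_order (u v : {perm dart H}) : #[v] = #[u] -> #[(u, v)] = #[u].
  move=> uv; apply/eqP; rewrite eqn_dvd !order_dvdn pair_exp expg_order
    -{1}uv expg_order eqxx /=.
  by have := expg_order (u, v); rewrite pair_exp => -[->].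
have oa : #[a] = l by rewrite -(inj_morph_order _ iM iI) ia pair_order ?orderV.
have ob : #[b] = m by rewrite -(inj_morph_order _ iM iI) ib pair_order ?orderV.
(* The second coordinate [x^-1 * y^-1] is inverse to [y * x], a conjugate of [x * y]. *)
have oab : #[a * b] = n.
  rewrite -(inj_morph_order _ iM iI) iM ia ib pair_order //.
  rewrite -invMg orderV -[y * x](mulKg x) (mulgA x) -conjgE.
  by rewrite orderJ.
have [Q [a' [b' [oa' ob' oab' proj [w0 [w01 w0f]]]]]] :=
  chiral_cover gen oa ob oab nonsph sgM sgK (sg_inv _ _ ia) (sg_inv _ _ ib).
have [gT' [a0 [b0 [i' [i'M i'I ia' ib' gen']]]]] := generated_subgroup a' b'.
have sub_triple w : weval (triple a0 b0) w = 1 <-> weval (triple a' b') w = 1.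
  have i1 := morph_one i'M.
  by rewrite -ia' -ib' -morph_weval_triple // -i1; split=> [->|/i'I].
exists (regular_hypermap gen'); split.
- have := regular_type gen'.
  by rewrite -!(inj_morph_order _ i'M i'I) i'M ia' ib' oa' ob' oab'.
- exact: regular_regular.
- move=> w /regular_hol/sub_triple/proj/(congr1 iota).
  have i1 := morph_one iM.
  rewrite i1 morph_weval_triple // ia ib => E; rewrite /hol weval_flip.
  have := congr1 fst E; have := congr1 snd E.
  by rewrite !morph_weval_triple.
- exists w0; split; first by apply/regular_hol/sub_triple.
  by move/regular_hol/sub_triple; rewrite weval_flip.
Qed.

(** * The extended triangle group *)

Section DoubledPerm.
Variable D : finType.

Lemma double_subproof (P Q : {perm D}) :
  injective (fun u : D * bool => (if u.2 then Q u.1 else P u.1, u.2)).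
Proof. by move=> [d [] ] [d' [] ] //= [] /perm_inj ->. Qed.

Definition double (P Q : {perm D}) : {perm D * bool} := perm (@double_subproof P Q).

Lemma double0 P Q d : double P Q (d, false) = (P d, false).
Proof. by rewrite permE. Qed.

Lemma doubleM P Q P' Q' : double P Q * double P' Q' = double (P * P') (Q * Q').
Proof. by apply/permP => -[d []]; rewrite permM !permE /= ?permE. Qed.

Lemma double1 : double 1 1 = 1.
Proof. by apply/permP => -[d []]; rewrite permE /= !perm1. Qed.

Lemma doubleX P Q k : double P Q ^+ k = double (P ^+ k) (Q ^+ k).
Proof. by elim: k => [|k IHk]; rewrite ?expg0 ?double1 // !expgS IHk doubleM. Qed.

Lemma doubleV P Q : (double P Q)^-1 = double P^-1 Q^-1.
Proof. by apply: (mulgI (double P Q)); rewrite mulgV doubleM !mulgV double1. Qed.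

Lemma sheet_subproof : injective (fun u : D * bool => (u.1, ~~ u.2)).
Proof. by move=> [d s] [d' s'] [-> /negb_inj ->]. Qed.

Definition sheet : {perm D * bool} := perm sheet_subproof.

Lemma sheetK : sheet * sheet = 1.
Proof. by apply/permP => -[d s]; rewrite permM !permE /= negbK. Qed.

Lemma sheetJ P Q : sheet * double P Q * sheet = double Q P.
Proof. by apply/permP => -[d []]; rewrite !permM !permE. Qed.
End DoubledPerm.

Section Inclusion.
Variables (l m n : nat).
Let r i : ext_triangle_group l m n := pgen _ i.

Lemma ext_rels w : w \in ext_triangle_rels l m n ->
  weval (fun i => pgen (ext_triangle_rels l m n) i) w = 1.
Proof. exact: weval_pgen_rel. Qed.

Lemma reflection_sqr i : r i * r i = 1.
Proof.
have := @ext_rels (wpow (letter i) 2); rewrite weval_pow weval_letter expg2; apply.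
by rewrite !inE; case: (ord3P i) => ->; rewrite eqxx ?orbT.
Qed.

Lemma reflectionV i : (r i)^-1 = r i.
Proof. by apply: (mulgI (r i)); rewrite mulgV reflection_sqr. Qed.

Lemma triangle_inclE (w : word 'I_3) :
  triangle_incl (\pi_(presented (triangle_rels l m n)) w) =
  weval (triple (r i1 * r i2) (r i2 * r i0)) w.
Proof.
have z : ((r i1 * r i2) * (r i2 * r i0))^-1 = r i0 * r i1.
  by rewrite -mulgA (mulgA (r i2)) reflection_sqr mul1g invMg !reflectionV.
rewrite /triangle_incl -/(r i0) -/(r i1) -/(r i2) /triple z; apply: pliftE.
rewrite -z; apply: triple_rels.
- have := @ext_rels (wpow (letter i1 ++ letter i2) l).
  by rewrite weval_pow weval_cat !weval_letter; apply; rewrite !inE eqxx ?orbT.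
- have := @ext_rels (wpow (letter i2 ++ letter i0) m).
  by rewrite weval_pow weval_cat !weval_letter; apply; rewrite !inE eqxx ?orbT.
- rewrite -[X in X ^+ n]invgK z expVgn; apply/eqP; rewrite invg_eq1; apply/eqP.
  have := @ext_rels (wpow (letter i0 ++ letter i1) n).
  by rewrite weval_pow weval_cat !weval_letter; apply; rewrite !inE eqxx ?orbT.
Qed.

Lemma triangle_incl_flip (w : word 'I_3) :
  triangle_incl (\pi_(presented (triangle_rels l m n)) (flip w)) =
  triangle_incl (\pi_(presented (triangle_rels l m n)) w) ^ r i2.
Proof.
rewrite !triangle_inclE weval_flip.
rewrite (morph_weval_triple _ _ _ (phi := fun g => g ^ r i2)); last first.
  by move=> g h; exact: conjMg.
congr (weval (triple _ _) w).
  by rewrite conjgE invMg !reflectionV !mulgA -(mulgA _ (r i2)) reflection_sqr mulg1.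
by rewrite conjgE invMg !reflectionV !mulgA reflection_sqr mul1g.
Qed.

(* The action of Delta on the darts is induced up to Delta^* on two copies of
   the darts, so that it can be read off from the image in Delta^*. *)
Lemma monodromy_incl (K : hypermap) (g h : triangle_group l m n) :
  has_type l m n K -> triangle_incl g = triangle_incl h ->
  monodromy l m n K g = monodromy l m n K h.
Proof.
move=> KT; have [hl [hm hn]] := hx_hy_order KT.
pose x := hx K; pose y := hy K; pose X := double x x^-1; pose Y := double y y^-1.
pose t := sheet (dart K).
have tX : t * X * t = X^-1 by rewrite sheetJ doubleV invgK.
have tY : t * Y * t = Y^-1 by rewrite sheetJ doubleV invgK.
have tt : t * t = 1 by exact: sheetK.
(* With [r_2] acting as the exchange of sheets, [x = r_1 r_2] and [y = r_2 r_0] force the other two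
   reflections. *)
pose R : 'I_3 -> {perm dart K * bool} := ord3_case (t * Y) (X * t) t.
have XYn : (X * Y) ^+ n = 1.
  rewrite doubleM doubleX -hn expg_order -invMg.
  have -> : y * x = (x * y) ^ x by rewrite conjgE !mulgA mulVg mul1g.
  by rewrite expVgn -conjXg expg_order conj1g invg1 double1.
have Rrels w : w \in ext_triangle_rels l m n -> weval R w = 1.
  have R12 : X * t * t = X by rewrite -mulgA tt mulg1.
  have R20 : t * (t * Y) = Y by rewrite mulgA tt mul1g.
  rewrite !inE; case/or4P => [|||/or3P[]] /eqP ->;
    rewrite weval_pow ?weval_cat !weval_letter /R /ord3_case ?eqxx ?i10 ?i20 ?i21 ?expg2.
  - by rewrite mulgA tY mulVg.
  - by rewrite -mulgA (mulgA t) tX mulgV.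
  - by [].
  - by rewrite R12 doubleX -hl expg_order expVgn expg_order invg1 double1.
  - by rewrite R20 doubleX -hm expg_order expVgn expg_order invg1 double1.
  - have -> : t * Y * (X * t) = (X * Y)^-1.
      by rewrite invMg -tX -tY !mulgA -(mulgA _ t t) tt mulg1.
    by rewrite expVgn XYn invg1.
have ext w : plift R (triangle_incl (\pi_(presented (triangle_rels l m n)) w)) =
    weval (triple X Y) w.
  rewrite triangle_inclE morph_weval_triple; last exact: pliftM.
  rewrite !(pliftM Rrels) !(plift_gen Rrels) /R /ord3_case ?eqxx ?i10 ?i20 ?i21.
  by rewrite -mulgA tt mulg1 mulgA tt mul1g.
have XY w d : weval (triple X Y) w (d, false) = (hol K w d, false).
  suff -> : weval (triple X Y) w = double (hol K w) (weval (triple x^-1 y^-1) w).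
    by rewrite double0.
  have := @morph_weval_triple ({perm dart K} * {perm dart K})%type _
    (fun u => double u.1 u.2) (x, x^-1) (y, y^-1) w.
  rewrite /= => <-; last by move=> u v; rewrite doubleM.
  by congr double; rewrite ?/hol;
    [rewrite (morph_weval_triple (phi := fst))
    | rewrite (morph_weval_triple (phi := snd))].
rewrite -[g]reprK -[h]reprK => /(congr1 (plift R)); rewrite !ext => E.
rewrite !monodromyE //; apply/permP => d.
by have := congr1 (fun P : {perm _} => P (d, false)) E; rewrite !XY => -[].
Qed.
End Inclusion.

(** * Chirality and the tower of covers *)

(** Normality under [r_2] would give a [g] in the kernel with the same image as [flip w];
    [monodromy_incl] then makes [flip w] act trivially, with no appeal to injectivity of the
    inclusion. *)
Lemma hol_chiral l m n (K : hypermap) w :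
  has_type l m n K -> hol K w = 1 -> hol K (flip w) <> 1 -> chiral l m n K.
Proof.
move=> KT w1 wf refl; apply: wf.
have Kw : hypermap_subgroup l m n K (\pi_(presented _) w).
  by rewrite /hypermap_subgroup /= monodromyE.
have [g Kg] := refl _ (pgen _ i2) (ex_intro2 _ _ _ Kw erefl).
rewrite -triangle_incl_flip => /(monodromy_incl KT) E.
by rewrite -(monodromyE _ KT) -E; exact: Kg.
Qed.

Lemma iso_hol (H K : hypermap) w :
  isomorphic H K -> hol H w = 1 <-> hol K w = 1.
Proof.
case=> f [[f' fK f'K] fx fy fz].
have fV (P : {perm dart H}) (Q : {perm dart K}) :
    (forall d, f (P d) = Q (f d)) -> forall d, f (P^-1 d) = Q^-1 (f d).
  by move=> PQ d; apply: (@perm_inj _ Q); rewrite -PQ !permKV.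
have ftri i d : f (triple (hx H) (hy H) i d) = triple (hx K) (hy K) i (f d).
  by rewrite /triple -!hzE /ord3_case; case: ifP => _ //; case: ifP.
have fhol d : f (hol H w d) = hol K w (f d).
  rewrite /hol; elim: w d => [|[i s] w IHw] d; first by rewrite /weval !big_nil !perm1.
  rewrite /weval !big_cons !permM -/(weval _ w) IHw.
  by case: s => /=; rewrite ?(fV _ _ (ftri i)) ?ftri.
split=> E; apply/permP => d; rewrite perm1.
  by rewrite -(f'K d) -fhol E perm1.
by apply: (can_inj fK); rewrite fhol E perm1.
Qed.

Theorem theorem2p1 (l m n : nat) (l_gt0 : (0 < l)%N) (m_gt0 : (0 < m)%N)
    (n_gt0 : (0 < n)%N)
    (nonspherical :
      ((l%:R^-1 + m%:R^-1 + n%:R^-1 : rat) <= 1)%R)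
    (H : hypermap) (H_type : has_type l m n H)
    (H_regular : orientably_regular H) :
  exists K : nat -> hypermap,
    (forall i : nat,
       [/\ has_type l m n (K i), orientably_regular (K i),
           chiral l m n (K i) & covers l m n (K i) H]) /\
    (forall i j : nat, i <> j -> ~ isomorphic (K i) (K j)).
Proof.
(* The type is a premise inside the existential so that [choice] yields a total function; [L] itself
   is the default value. *)
have step (L : hypermap) : exists M : hypermap, has_type l m n L ->
    [/\ has_type l m n M, orientably_regular M,
        forall w, hol M w = 1%g -> hol L w = 1%g /\ hol L (flip w) = 1%g &
        exists w, hol M w = 1%g /\ hol M (flip w) <> 1%g].
  case: (EM (has_type l m n L)) => [LT|nLT]; last by exists L.
  by have [M MP] := chiral_cover_hol nonspherical LT; exists M.
have [F FP] := choice step.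
(* The shift by one leaves out [H] itself, which may be reflexible. *)
pose K i := iter i.+1 F H.
have KT i : has_type l m n (iter i F H).
  by elim: i => //= i /FP[].
have desc i j w : (i < j)%N -> hol (iter j F H) w = 1%g ->
    hol (iter i F H) w = 1%g /\ hol (iter i F H) (flip w) = 1%g.
  elim: j => // j IHj; rewrite ltnS leq_eqVlt => /orP[/eqP->|ij] wj.
    by have [_ _ + _] := FP _ (KT j); apply.
  by apply: IHj => //; have [_ _ /(_ w wj)[]] := FP _ (KT j).
(* The word that witnesses the chirality of [K i] would be trivial in the higher cover [K j], where
   triviality forces its flip to be trivial in [K i]. *)
have not_iso i j : (i < j)%N ->
    (forall w, hol (K i) w = 1%g <-> hol (K j) w = 1%g) -> False.
  move=> ij E; have [_ _ _ [w [w1]]] := FP _ (KT i); apply.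
  by have [] := desc i.+1 j.+1 w ij ((E w).1 w1).
exists K; split=> [i|i j ij iso].
  have [FT FR _ [w [w1 wf]]] := FP _ (KT i); split=> //.
    exact: hol_chiral FT w1 wf.
  move=> g; rewrite /hypermap_subgroup /= -[g]generic_quotient.reprK !monodromyE //.
  by move/(desc 0 i.+1) => /(_ erefl)[].
have E w := iso_hol w iso; case: (ltngtP i j) => // lt_ij.
  exact: not_iso lt_ij E.
by apply: (not_iso _ _ lt_ij) => w; split=> /E.
Qed.
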